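(* Let $K$ be any field. The Lie superalgebra $\mathbf Q=\mathrm{Lie}(v_0,v_1,v_2)$ is just infinite, i.e. it is infinite-dimensional and every nonzero ideal of $\mathbf Q$ has finite codimension in $\mathbf Q$.
   Context: $\Lambda$ is the Grassmann algebra over $K$ on odd generators $x_0,x_1,\dots$; $x_i$ is identified with left multiplication; $\partial_i$ is the odd superderivation with $\partial_i(x_j)=\delta_{ij}$; pivot elements $v_i=\sum_{k\ge0}\big(\prod_{n=0}^{k-1}x_{i+3n}x_{i+3n+1}\big)\partial_{i+3k}$, $i\ge0$. $\mathbf Q$ is the Lie subsuperalgebra of $(\operatorname{End}\Lambda)^{(-)}$ (supercommutator $[a,b]=ab-(-1)^{|a||b|}ba$) generated by $v_0,v_1,v_2$; in characteristic $2$ it is also closed under squaring of odd elements. *)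

(* Defs.v *)
From HB Require Import structures.
From mathcomp Require Import all_boot all_order all_algebra.
From mathcomp Require Import finmap.
From mathcomp Require Import monalg.

Set Implicit Arguments.
Unset Strict Implicit.
Unset Printing Implicit Defensive.

Import GRing.Theory.
Local Open Scope fset_scope.
Local Open Scope ring_scope.

Section Grassmann.
Variable K : fieldType.

(* The Grassmann algebra over K on odd generators x_0, x_1, ...:
   K-vector space with basis the monomials x_S = x_{i_1} ... x_{i_k}
   (i_1 < ... < i_k), indexed by finite sets S of naturals. *)
Definition Lam := {malg K[{fset nat}]}.

Definition mon (S : {fset nat}) : Lam := << S >>.

Definition sgnb (i : nat) (S : {fset nat}) : K :=
  (-1) ^+ count (fun j => (j < i)%N) (S : seq nat).

Definition lmulB (i : nat) (S : {fset nat}) : Lam :=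
  if i \in S then 0 else sgnb i S *: mon (i |` S).

(* the odd superderivation d_i (d_i(x_j) = delta_ij) on basis monomials *)
Definition derB (i : nat) (S : {fset nat}) : Lam :=
  if i \in S then sgnb i S *: mon (S `\ i) else 0.

Definition linext (B : {fset nat} -> Lam) (f : Lam) : Lam :=
  \sum_(S <- msupp f) f@_S *: B S.

Definition Op := Lam -> Lam.

Definition xop (i : nat) : Op := linext (lmulB i).
Definition dop (i : nat) : Op := linext (derB i).

Definition maxidx (f : Lam) : nat :=
  \max_(S <- msupp f) \max_(j <- (S : seq nat)) j.

Definition xprod (i k : nat) (g : Lam) : Lam :=
  foldr (fun n h => xop (i + 3 * n) (xop (i + 3 * n).+1 h)) g (iota 0 k).

(* pivot element v_i = sum_{k>=0} (prod_{n<k} x_{i+3n} x_{i+3n+1}) d_{i+3k};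
   on a given f only the terms with i+3k <= maxidx f can be nonzero,
   so the infinite sum is the following finite one. *)
Definition pivot (i : nat) : Op :=
  fun f => \sum_(k < (maxidx f).+1) xprod i k (dop (i + 3 * k) f).

Definition parity (S : {fset nat}) : bool := odd #|` S|.

Definition homog (p : bool) (a : Op) : Prop :=
  forall S T, T \in msupp (a (mon S)) -> parity T = parity S (+) p.

Definition proj (p : bool) (f : Lam) : Lam :=
  \sum_(S <- msupp f | parity S == p) f@_S *: mon S.

Definition part (p : bool) (a : Op) : Op :=
  fun f => proj p (a (proj false f)) + proj (~~ p) (a (proj true f)).

Definition opzero : Op := fun _ => 0.
Definition opadd (a b : Op) : Op := fun f => a f + b f.
Definition opscale (c : K) (a : Op) : Op := fun f => c *: a f.

Definition supbr (p q : bool) (a b : Op) : Op :=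
  fun f => a (b f) - (-1) ^+ (p && q) *: b (a f).

Definition opsq (a : Op) : Op := fun f => a (a f).

(* Q = Lie(v_0, v_1, v_2): smallest subspace of End Lambda containing
   v_0, v_1, v_2, closed under supercommutators (extended bilinearly) and
   under squaring of odd elements (the latter is automatic unless char K = 2,
   since a^2 = [a,a]/2 for odd a). *)
Inductive inQ : Op -> Prop :=
  | inQ_gen i : (i < 3)%N -> inQ (pivot i)
  | inQ_zero : inQ opzero
  | inQ_add a b : inQ a -> inQ b -> inQ (opadd a b)
  | inQ_scale c a : inQ a -> inQ (opscale c a)
  | inQ_br p q a b : inQ a -> inQ b -> homog p a -> homog q b ->
      inQ (supbr p q a b)
  | inQ_sq a : inQ a -> homog true a -> inQ (opsq a).

Definition lincomb (n : nat) (c : 'I_n -> K) (b : 'I_n -> Op) : Op :=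
  fun f => \sum_(j < n) c j *: b j f.

Definition Q_infinite_dim : Prop :=
  forall n : nat, exists b : 'I_n -> Op,
    (forall j, inQ (b j)) /\
    (forall c : 'I_n -> K, lincomb c b = opzero -> forall j, c j = 0).

Definition Q_ideal (I : Op -> Prop) : Prop :=
  (forall a, I a -> inQ a) /\
  I opzero /\
  (forall a b, I a -> I b -> I (opadd a b)) /\
  (forall c a, I a -> I (opscale c a)) /\
  (forall p a, I a -> I (part p a)) /\
  (forall p r q a, inQ q -> I a -> homog p q -> homog r a ->
                   I (supbr p r q a)) /\
  (forall a, I a -> homog true a -> I (opsq a)).

Definition finite_codim (I : Op -> Prop) : Prop :=
  exists n (b : 'I_n -> Op), forall q, inQ q ->
    exists (c : 'I_n -> K) (a : Op), I a /\ q = opadd a (lincomb c b).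

End Grassmann.

(* Main.v *)
(** Write x_s for left multiplication by the monomial with factors s. The pivots satisfy
      v_m^2 = x_{m+1} v_{m+3},   [v_m, v_{m+1}] = - x_m v_{m+3},
      [v_m, v_n] = x_m x_{m+1} [v_{m+3}, v_n]   (n >= m + 2),
    so Q lies in the span of the x_s v_m with s below m - 2 and of the
    x_{m+1} x_s v_{m+3} with s below m - 1. The latter come from [x_t v_m, x_u v_m] with
    a factor 2, or from v_m^2 when s is empty. Conversely, bracketing with v_j removes a
    factor x_j from x_s v_m, and bracketing x_0 ... x_{m-3} v_m with v_{m-2} gives
    x_0 ... x_m v_{m+3} up to sign. So once x_0 ... x_{m-3} v_m is in Q for m = 8, 9, 10,
    all x_s v_m with m >= 8 and s below m - 2 are in Q.

    Let a <> 0 be a homogeneous element of an ideal I. Take k large and t below k - 2,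
    containing an interval such that x_t [a, v_k] = 0, and with a(x_t) <> 0. Then I
    contains [a, x_t v_k] = c v_k, where c is multiplication by an element of the algebra
    generated by the x_j with j < k - 2, and c(1) = a(x_t) is not zero. Some monomial
    multiplies c to a nonzero multiple of the top monomial of that algebra, so a bracket
    with a multiple of v_{k+1}, followed by the removal of all factors x_j, puts v_{k+3}
    in I. Hence I contains all v_n with n large, and then all monomials of Q of large
    index. *)
From HB Require Import structures.
Require Import Defs.
From mathcomp Require Import all_boot all_order all_algebra.
From mathcomp Require Import zify ring finmap monalg.
From Stdlib Require Import FunctionalExtensionality Classical.

Set Implicit Arguments.
Unset Strict Implicit.
Unset Printing Implicit Defensive.

Import GRing.Theory.
Local Open Scope fset_scope.
Local Open Scope ring_scope.

(* Each f is killed by almost all pivots, so the recursion v_m = d_m + x_m x_{m+1} v_{m+3}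
   supports induction downwards. *)
Lemma down3_ind N (P : nat -> Prop) : (forall m, (N <= m)%N -> P m) ->
  (forall m, P m.+3 -> P m) -> forall m, P m.
Proof.
move=> PN PS m; have [n] := ubnP (N - m)%N; elim: n m => // n IH m.
by have [/PN //|Nm le_n] := leqP N m; apply/PS/IH; lia.
Qed.

Section LinearExtension.
Variable K : fieldType.
Notation Lam := (Lam K).
Notation mon := (mon K).
Implicit Types (f : Lam) (S : {fset nat}) (B : {fset nat} -> Lam).

Lemma linext_widen B (d : {fset {fset nat}}) f :
  msupp f `<=` d -> linext B f = \sum_(S <- d) f@_S *: B S.
Proof.
move=> sd; apply: big_fset_incl => // S _ Sf.
by rewrite mcoeff_outdom // scale0r.
Qed.

Lemma linext_is_linear B : linear (linext B).
Proof.
move=> c f g; pose d := msupp f `|` msupp g.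
have sf : msupp f `<=` d by apply: fsubsetUl.
have sg : msupp g `<=` d by apply: fsubsetUr.
have sfg : msupp (c *: f + g) `<=` d.
  by apply: fsubset_trans (msuppD_le _ _) _; apply/fsetSU/msuppZ_le.
rewrite (linext_widen B sf) (linext_widen B sg) (linext_widen B sfg).
rewrite scaler_sumr -big_split /=; apply: eq_bigr => S _.
by rewrite mcoeffD mcoeffZ scalerDl scalerA.
Qed.

HB.instance Definition _ (B : {fset nat} -> Lam) :=
  GRing.isLinear.Build K Lam Lam _ (linext B) (linext_is_linear B).
HB.instance Definition _ i := GRing.Linear.copy (@xop K i) (linext (lmulB K i)).
HB.instance Definition _ i := GRing.Linear.copy (@dop K i) (linext (derB K i)).

Lemma linext_mon B S : linext B (mon S) = B S.
Proof.
by rewrite /linext /mon msuppU oner_eq0 big_seq_fset1 mcoeffUU scale1r.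
Qed.

Lemma mon_sum f : f = \sum_(S <- msupp f) f@_S *: mon S.
Proof.
rewrite [LHS]monalgE; apply: eq_bigr => S _.
by apply/malgP => T; rewrite mcoeffZ /mon !mcoeffU mulrnAr mulr1.
Qed.

Lemma linear_mon_ext (a b : {linear Lam -> Lam}) :
  (forall S, a (mon S) = b (mon S)) -> a =1 b.
Proof.
move=> ab f; rewrite [f]mon_sum !linear_sum.
by apply: eq_bigr => S _; rewrite !linearZ /= ab.
Qed.

End LinearExtension.

(* Sealed, since otherwise unification unfolds the operators when it compares terms
   that differ in an index only. *)
HB.lock Definition x_ (K : fieldType) i : {linear Lam K -> Lam K} := @xop K i.
HB.lock Definition d_ (K : fieldType) i : {linear Lam K -> Lam K} := @dop K i.
Arguments x_ {K} i.
Arguments d_ {K} i.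

Section GrassmannRelations.
Variable K : fieldType.
Notation Lam := (Lam K).
Notation mon := (mon K).
Notation sgnb := (sgnb K).
Implicit Types (f g : Lam) (i j k m n : nat) (S : {fset nat}).

Lemma x_E i f : x_ i f = xop i f.
Proof. by rewrite unlock. Qed.

Lemma d_E i f : d_ i f = dop i f.
Proof. by rewrite unlock. Qed.

Lemma x_mon i S : x_ i (mon S) = if i \in S then 0 else sgnb i S *: mon (i |` S).
Proof. by rewrite x_E; apply: linext_mon. Qed.

Lemma d_mon i S : d_ i (mon S) = if i \in S then sgnb i S *: mon (S `\ i) else 0.
Proof. by rewrite d_E; apply: linext_mon. Qed.

Lemma sgnb_sq i S : sgnb i S * sgnb i S = 1.
Proof. by rewrite -expr2 sqrr_sign. Qed.

Lemma sgnbU1 i j S : j \notin S -> sgnb i (j |` S) = (-1) ^+ (j < i)%N * sgnb i S.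
Proof.
move=> jS; rewrite /sgnb -exprD; congr (_ ^+ _).
have /permP-> : perm_eq (j |` S : seq nat) (j :: (S : seq nat)) => //.
by apply: uniq_perm => [||x]; rewrite /= ?fset_uniq ?jS // in_fset1U inE.
Qed.

Lemma sgnbD1 i j S : j \in S -> sgnb i S = (-1) ^+ (j < i)%N * sgnb i (S `\ j).
Proof. by move=> jS; rewrite -{1}(fsetD1K jS) sgnbU1 ?fsetD11. Qed.

Lemma sign_ltC i j : i != j -> (-1) ^+ (j < i)%N = - (-1) ^+ (i < j)%N :> K.
Proof. by case: ltngtP => // _ _; rewrite ?opprK. Qed.

Lemma x_sq i f : x_ i (x_ i f) = 0.
Proof.
apply: (linear_mon_ext (a := x_ i \o x_ i) (b := \0)) => /= S.
rewrite x_mon; have [iS|iS] := boolP (i \in S); rewrite ?linear0 // linearZ /=.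
by rewrite x_mon fset1U1 scaler0.
Qed.

Lemma x_anticomm i j f : x_ i (x_ j f) = - x_ j (x_ i f).
Proof.
have [<-|ij] := eqVneq i j; first by rewrite x_sq oppr0.
apply: (linear_mon_ext (a := x_ i \o x_ j) (b := -%R \o (x_ j \o x_ i))) => /= S.
rewrite !x_mon; have [iS|iS] := boolP (i \in S); have [jS|jS] := boolP (j \in S).
- by rewrite !linear0.
- by rewrite linear0 oppr0 linearZ /= x_mon in_fset1U iS orbT scaler0.
- by rewrite linear0 linearZ /= x_mon in_fset1U jS orbT scaler0 oppr0.
rewrite !linearZ /= !x_mon !in_fset1U [j == i]eq_sym (negbTE ij) (negbTE iS).
rewrite (negbTE jS) /= (sgnbU1 _ iS) (sgnbU1 _ jS) (sign_ltC ij) fsetUCA scalerN !scalerA.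
by rewrite -scaleNr; apply: (congr1 ( *:%R^~ _)); ring.
Qed.

Lemma d_sq i f : d_ i (d_ i f) = 0.
Proof.
apply: (linear_mon_ext (a := d_ i \o d_ i) (b := \0)) => /= S.
rewrite d_mon; have [iS|iS] := boolP (i \in S); rewrite ?linear0 // linearZ /=.
by rewrite d_mon fsetD11 scaler0.
Qed.

Lemma d_anticomm i j f : d_ i (d_ j f) = - d_ j (d_ i f).
Proof.
have [<-|ij] := eqVneq i j; first by rewrite d_sq oppr0.
apply: (linear_mon_ext (a := d_ i \o d_ j) (b := -%R \o (d_ j \o d_ i))) => /= S.
rewrite !d_mon; have [iS|iS] := boolP (i \in S); have [jS|jS] := boolP (j \in S).
- rewrite !linearZ /= !d_mon !in_fsetD1 [j == i]eq_sym ij iS jS /=.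
  rewrite (sgnbD1 j iS) (sgnbD1 i jS) (sign_ltC ij) scalerN !scalerA -scaleNr.
  have -> : S `\ j `\ i = S `\ i `\ j by rewrite fsetDDl fsetUC -fsetDDl.
  by apply: (congr1 ( *:%R^~ _)); ring.
- rewrite linear0 linearZ /= d_mon in_fsetD1 (negbTE jS) andbF.
  by rewrite scaler0 oppr0.
- by rewrite linear0 oppr0 linearZ /= d_mon in_fsetD1 (negbTE iS) andbF scaler0.
by rewrite !linear0.
Qed.

Lemma d_x i f : d_ i (x_ i f) = f - x_ i (d_ i f).
Proof.
apply: (linear_mon_ext (a := d_ i \o x_ i) (b := idfun \- (x_ i \o d_ i))) => /= S.
rewrite x_mon d_mon; have [iS|iS] := boolP (i \in S).
  rewrite !linear0 linearZ /= x_mon fsetD11 fsetD1K // scalerA.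
  by rewrite (sgnbD1 i iS) ltnn mul1r sgnb_sq scale1r subrr.
rewrite !linear0 ?addr0 linearZ /= d_mon fset1U1 fsetU1K // scalerA.
by rewrite (sgnbU1 _ iS) ltnn mul1r sgnb_sq scale1r.
Qed.

Lemma d_x_neq i j f : i != j -> d_ i (x_ j f) = - x_ j (d_ i f).
Proof.
move=> ij.
apply: (linear_mon_ext (a := d_ i \o x_ j) (b := -%R \o (x_ j \o d_ i))) => /= S.
rewrite x_mon d_mon; have [iS|iS] := boolP (i \in S); last first.
  rewrite linear0 oppr0; have [jS|jS] := boolP (j \in S); first by rewrite linear0.
  by rewrite linearZ /= d_mon in_fset1U (negbTE ij) (negbTE iS) scaler0.
have [jS|jS] := boolP (j \in S).
  by rewrite linear0 linearZ /= x_mon in_fsetD1 eq_sym ij jS scaler0 oppr0.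
rewrite !linearZ /= d_mon x_mon in_fset1U iS orbT in_fsetD1 (negbTE jS) andbF.
rewrite (sgnbU1 _ jS) (sign_ltC ij) (sgnbD1 j iS) scalerN !scalerA -scaleNr.
have -> : (j |` S) `\ i = j |` (S `\ i).
  by apply/fsetP => x; rewrite !inE; case: (eqVneq x j) => // ->; rewrite eq_sym ij.
by apply: (congr1 ( *:%R^~ _)); rewrite mulrACA mulrN -expr2 sqrr_sign; ring.
Qed.

Lemma dop_gt_maxidx j f : (maxidx f < j)%N -> dop j f = 0.
Proof.
move=> fj; rewrite /dop /linext big_seq big1 // => S Sf; rewrite /derB.
case: ifP => [jS|_]; last exact: scaler0.
suff: (j <= maxidx f)%N by rewrite leqNgt fj.
by apply: leq_trans (leq_bigmax_seq _ Sf isT); apply: leq_bigmax_seq.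
Qed.

Lemma xprodS i k f : xprod i k.+1 f = x_ i (x_ i.+1 (xprod i.+3 k f)).
Proof.
rewrite !x_E /xprod /= muln0 addn0 (iotaDl 1 0); do 2 apply: congr1.
elim: (iota 0 k) => [|n s IH] /=; first by [].
by rewrite [in LHS]IH mulnDr muln1 addnA addn3.
Qed.

Lemma xprod0 i k : xprod i k 0 = 0 :> Lam.
Proof. by rewrite /xprod; elim: (iota 0 k) => //= n s ->; rewrite !linear0. Qed.

Lemma pivot_widen n i f : (maxidx f < n)%N ->
  pivot i f = \sum_(k < n) xprod i k (dop (i + 3 * k) f).
Proof.
move=> fn; pose F k := xprod i k (dop (i + 3 * k) f).
rewrite /pivot (big_ord_widen n F fn) [LHS]big_mkcond.
apply: eq_bigr => k _; case: ifP => // kf.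
by rewrite dop_gt_maxidx ?xprod0 //; lia.
Qed.

Lemma pivot_rec m f : pivot m f = d_ m f + x_ m (x_ m.+1 (pivot m.+3 f)).
Proof.
rewrite (pivot_widen m (leqnSn _)) (pivot_widen m.+3 (leqnn _)) big_ord_recl.
rewrite muln0 addn0 d_E (linear_sum (x_ m.+1)) (linear_sum (x_ m)); congr (_ + _).
by apply: eq_bigr => k _; rewrite [LHS]xprodS /= /bump add1n mulnS addnA addn3.
Qed.

Lemma pivot_gt_maxidx m f : (maxidx f < m)%N -> pivot m f = 0.
Proof.
by move=> fm; rewrite /pivot big1 // => k _; rewrite dop_gt_maxidx ?xprod0 //; lia.
Qed.

Lemma pivot_is_linear m : linear (@pivot K m).
Proof.
move=> c f g; pose N := maxn (maxidx (c *: f + g)) (maxn (maxidx f) (maxidx g)).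
elim/(@down3_ind N.+1): m => m; rewrite ?gtn_max.
  case/and3P=> fgm fm gm.
  by rewrite !pivot_gt_maxidx // scaler0 addr0.
by move=> IH; rewrite !(pivot_rec m) IH !linearP scalerDr addrACA.
Qed.

End GrassmannRelations.

HB.instance Definition _ (K : fieldType) m :=
  GRing.isLinear.Build K _ _ _ (@pivot K m) (@pivot_is_linear K m).
HB.lock Definition v_ (K : fieldType) m : {linear Lam K -> Lam K} := @pivot K m.
Arguments v_ {K} m.

Section JustInfinite.
Variable K : fieldType.
Notation Lam := (Lam K).
Notation Op := (Op K).
Notation mon := (mon K).
Notation opzero := (@opzero K).
Notation inQ := (@inQ K).
Notation v_ := (@v_ K).
Notation x_ := (@x_ K).
Notation d_ := (@d_ K).
Notation below n := (all (gtn n%N)).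
Notation one := (mon fset0).
Implicit Types (f g h : Lam) (S T : {fset nat}) (x y : K).
Implicit Types (i j k m n B M N : nat) (s t l : seq nat) (p q r : bool).
Implicit Types (a b c : Op) (G H : Op -> Prop).

Lemma v_E m f : v_ m f = pivot m f.
Proof. by rewrite unlock. Qed.

Lemma v_rec m f : v_ m f = d_ m f + x_ m (x_ m.+1 (v_ m.+3 f)).
Proof. by rewrite !v_E [LHS]pivot_rec. Qed.

Lemma v_gt_maxidx m f : (maxidx f < m)%N -> v_ m f = 0.
Proof. by rewrite v_E; apply: pivot_gt_maxidx. Qed.

Lemma v_x_lt m j f : (j < m)%N -> v_ m (x_ j f) = - x_ j (v_ m f).
Proof.
pose N := maxn (maxidx (x_ j f)) (maxidx f).
elim/(@down3_ind N.+1): m => m; rewrite ?gtn_max.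
  by case/andP=> xm fm _; rewrite !v_gt_maxidx // linear0 oppr0.
move=> IH jm; rewrite !(v_rec m) IH; last by lia.
rewrite d_x_neq; last by lia.
rewrite linearD opprD !linearN /= (x_anticomm m.+1 j) linearN /=.
by rewrite (x_anticomm m j) opprK.
Qed.

Lemma v_d_lt m j f : (j < m)%N -> v_ m (d_ j f) = - d_ j (v_ m f).
Proof.
pose N := maxn (maxidx (d_ j f)) (maxidx f).
elim/(@down3_ind N.+1): m => m; rewrite ?gtn_max.
  by case/andP=> xm fm _; rewrite !v_gt_maxidx // linear0 oppr0.
move=> IH jm; rewrite !(v_rec m) IH; last by lia.
have jm1 : j != m.+1 by lia.
have {jm} jm : j != m by lia.
rewrite d_anticomm (linearD (d_ j)) opprD !linearN /= (d_x_neq _ jm) (d_x_neq _ jm1).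
by rewrite (linearN (x_ m)) /= opprK.
Qed.

(** * Supercommutators and spans of operators *)

Lemma transport_op (P : Op -> Prop) a b : a =1 b -> P a -> P b.
Proof. by move=> /functional_extensionality ->. Qed.

Lemma linear_opZ a (la : linear a) x f : a (x *: f) = x *: a f.
Proof. exact: (GRing.scalable_linear la). Qed.

Lemma linear_opB a (la : linear a) f g : a (f - g) = a f - a g.
Proof. exact: (GRing.zmod_morphism_linear la). Qed.

Lemma linear_op0 a (la : linear a) : a 0 = 0.
Proof. by rewrite -[X in a X](scale0r 0) (linear_opZ la) scale0r. Qed.

Lemma linear_opE a : linear a -> a =1 linext (a \o mon).
Proof.
move=> la; pose linear_a := GRing.isLinear.Build K _ _ _ a la.
pose A := HB.pack_for {linear Lam -> Lam} a linear_a.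
by apply: (linear_mon_ext (a := A) (b := linext (a \o mon))) => S; rewrite /= linext_mon.
Qed.

Lemma linear_mon_eq0 a : linear a -> (forall S, a (mon S) = 0) -> a =1 opzero.
Proof.
move=> la a0 f; rewrite (linear_opE la) /linext big1 // => S _.
by rewrite /= a0 scaler0.
Qed.

Lemma supbrC p q a b f :
  supbr p q a b f = - (-1) ^+ (p && q) *: supbr q p b a f.
Proof.
rewrite /supbr [q && p]andbC scalerBr !scalerA mulNr -expr2 sqrr_sign.
by rewrite !scaleNr scale1r opprK addrC.
Qed.

Lemma supbr_compr b (lb : linear b) p q r a c f :
  supbr p (q (+) r) a (b \o c) f =
  supbr p q a b (c f) + (-1) ^+ (p && q) *: b (supbr p r a c f).
Proof.
rewrite /supbr /= andb_addr signr_addb.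
rewrite (linear_opB lb) (linear_opZ lb) scalerBr scalerA.
by rewrite addrA subrK.
Qed.

Lemma supbr_compl a (la : linear a) p q r b c f :
  supbr (p (+) q) r (a \o b) c f =
  a (supbr q r b c f) + (-1) ^+ (q && r) *: supbr p r a c (b f).
Proof.
rewrite /supbr /= andb_addl signr_addb mulrC.
rewrite (linear_opB la) (linear_opZ la) scalerBr scalerA.
by rewrite addrA subrK.
Qed.

Lemma supbrDZl c (lc : linear c) p q x a b :
  supbr p q (opadd (opscale x a) b) c =
  opadd (opscale x (supbr p q a c)) (supbr p q b c).
Proof.
apply: functional_extensionality => f.
rewrite /supbr /opadd /opscale lc !scalerDr !scalerN !scalerA opprD addrACA.
by rewrite [x * _]mulrC.
Qed.

Lemma supbrDZr c (lc : linear c) p q x a b :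
  supbr p q c (opadd (opscale x a) b) =
  opadd (opscale x (supbr p q c a)) (supbr p q c b).
Proof.
apply: functional_extensionality => f.
rewrite /supbr /opadd /opscale lc !scalerDr !scalerN !scalerA opprD addrACA.
by rewrite [x * _]mulrC.
Qed.

Lemma linear_opadd a b : linear a -> linear b -> linear (opadd a b).
Proof. by move=> la lb x f g; rewrite /opadd la lb scalerDr addrACA. Qed.

Lemma linear_opscale x a : linear a -> linear (opscale x a).
Proof.
move=> la y f g; rewrite /opscale la scalerDr !scalerA.
by rewrite mulrC.
Qed.

Lemma linear_comp a b : linear a -> linear b -> linear (a \o b).
Proof. by move=> la lb x f g; rewrite /= lb la. Qed.

Lemma linear_supbr p q a b : linear a -> linear b -> linear (supbr p q a b).
Proof.
move=> la lb x f g; rewrite /supbr !la !lb !la !scalerDr opprD addrACA.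
by rewrite !scalerN !scalerA mulrC.
Qed.

Inductive opspan G : Op -> Prop :=
  | opspan0 : opspan G opzero
  | opspanDZ x a b : G a -> opspan G b -> opspan G (opadd (opscale x a) b).

Lemma opspanZ G x a : opspan G a -> opspan G (opscale x a).
Proof.
elim=> [|y b c Gb _ IH].
  by apply: transport_op (opspan0 G) => f; rewrite /opscale scaler0.
apply: transport_op (opspanDZ (x * y) Gb IH) => f.
by rewrite /opadd /opscale scalerDr scalerA.
Qed.

Lemma opspanD G a b : opspan G a -> opspan G b -> opspan G (opadd a b).
Proof.
move=> + Gb; elim=> [|x c d Gc _ IH].
  by apply: transport_op Gb => f; rewrite /opadd add0r.
by apply: transport_op (opspanDZ x Gc IH) => f; rewrite /opadd addrA.
Qed.

Lemma mem_opspan G a : G a -> opspan G a.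
Proof.
move=> Ga; apply: transport_op (opspanDZ 1 Ga (opspan0 G)) => f.
by rewrite /opadd /opscale scale1r addr0.
Qed.

Lemma opspan_minimal G (P : Op -> Prop) a : P opzero ->
  (forall b c, P b -> P c -> P (opadd b c)) -> (forall x b, P b -> P (opscale x b)) ->
  (forall b, G b -> P b) -> opspan G a -> P a.
Proof. by move=> P0 PD PZ GP; elim=> [//|x b c /GP Pb _]; apply/PD/PZ. Qed.

Lemma sub_opspan G H a : (forall b, G b -> opspan H b) -> opspan G a -> opspan H a.
Proof. exact: opspan_minimal (opspan0 H) (@opspanD H) (@opspanZ H). Qed.

Lemma opspan_linear G a : (forall b, G b -> linear b) -> opspan G a -> linear a.
Proof.
apply: opspan_minimal; [|exact: linear_opadd|exact: linear_opscale].
by move=> x f g; rewrite /opzero scaler0 addr0.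
Qed.

Lemma opspan_map G H (F : Op -> Op) a :
  (forall x b c, F (opadd (opscale x b) c) = opadd (opscale x (F b)) (F c)) ->
  (forall b, G b -> opspan H (F b)) -> opspan G a -> opspan H (F a).
Proof.
move=> FDZ GH; elim=> [|x b c /GH Hb _ IH]; last by rewrite FDZ; apply/opspanD/IH/opspanZ.
have F0 : opadd (opscale (-1) (F opzero)) (F opzero) =1 F opzero.
  rewrite -FDZ => f; congr (F _ _); apply: functional_extensionality => h.
  by rewrite /opadd /opscale scaler0 addr0.
apply: (transport_op F0); apply: transport_op (opspan0 H) => f.
by rewrite /opadd /opscale scaleN1r addNr.
Qed.

Lemma opspan_comp G H a b c : linear b ->
  (forall d, G d -> opspan H (b \o d \o c)) -> opspan G a -> opspan H (b \o a \o c).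
Proof.
move=> lb; apply: (opspan_map (F := fun a => b \o a \o c)) => x d e.
by apply: functional_extensionality => f; apply: lb.
Qed.

Lemma opspan_supbr G G' H p q a b :
  (forall c, G c -> linear c) -> (forall d, G' d -> linear d) ->
  (forall c d, G c -> G' d -> opspan H (supbr p q c d)) ->
  opspan G a -> opspan G' b -> opspan H (supbr p q a b).
Proof.
move=> lG lG' GG' Ga G'b; have lb := opspan_linear lG' G'b.
apply: (opspan_map (F := fun a => supbr p q a b)) Ga => [x c d|c Gc].
  exact: supbrDZl.
have lc := lG _ Gc; apply: (opspan_map (F := supbr p q c)) G'b => [x d d'|d G'd].
  exact: supbrDZr.
exact: GG'.
Qed.

Lemma opspan_supbr_eq0 G p q a b c : linear b -> linear c ->
  (forall d, G d -> forall f, b (supbr p q d c f) = 0) -> opspan G a ->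
  forall f, b (supbr p q a c f) = 0.
Proof.
move=> lb lc Gbc; elim=> [|x d e /Gbc bd _ be] f.
  by rewrite /supbr /opzero (linear_op0 lc) scaler0 subr0 (linear_op0 lb).
rewrite (supbrDZl lc); apply: etrans (lb _ _ _) _.
apply: etrans (congr2 (fun g h => x *: g + h) (bd f) (be f)) _.
by rewrite scaler0 addr0.
Qed.

Lemma opspan_lincomb (I : finType) (e : I -> Op) G a :
  (forall b, G b -> exists x (i : I), b = opscale x (e i)) -> opspan G a ->
  exists x : 'I_#|I| -> K, a = lincomb x (e \o enum_val).
Proof.
move=> Ge; elim=> [|x _ b /Ge[y [i ->]] _ [z ->]].
  exists (fun=> 0); apply: functional_extensionality => f.
  by rewrite /lincomb big1 // => j _; rewrite scale0r.
exists (fun j : 'I_#|I| => (if j == enum_rank i then x * y else 0) + z j).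
apply: functional_extensionality => f; rewrite /opadd /opscale /lincomb.
under [RHS]eq_bigr do rewrite scalerDl.
rewrite big_split; congr (_ + _); rewrite (bigD1 (enum_rank i)) //= eqxx.
rewrite big1 => [|j /negbTE ->]; last by rewrite scale0r.
by rewrite addr0 enum_rankK scalerA.
Qed.

Lemma lincombD n (x y : 'I_n -> K) (b : 'I_n -> Op) :
  lincomb (fun j : 'I_n => x j + y j) b = opadd (lincomb x b) (lincomb y b).
Proof.
apply: functional_extensionality => f.
by rewrite /opadd /lincomb -big_split; apply: eq_bigr => j _; rewrite scalerDl.
Qed.

(** * Parity *)

Definition graded p f := forall T, T \in msupp f -> parity T = p.

Lemma graded0 p : graded p 0.
Proof. by move=> T; rewrite msupp0. Qed.

Lemma gradedD p f g : graded p f -> graded p g -> graded p (f + g).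
Proof.
move=> pf pg T /(fsubsetP (msuppD_le _ _)); rewrite in_fsetU.
by case/orP=> [/pf|/pg].
Qed.

Lemma gradedZ p x f : graded p f -> graded p (x *: f).
Proof. by move=> pf T /(fsubsetP (msuppZ_le _ _)) /pf. Qed.

Lemma graded_mon S : graded (parity S) (mon S).
Proof. by move=> T /(fsubsetP msuppU_le); rewrite inE => /eqP ->. Qed.

Lemma graded_linext p q (B : {fset nat} -> Lam) f :
  (forall S, graded (parity S (+) q) (B S)) -> graded p f ->
  graded (p (+) q) (linext B f).
Proof.
move=> HB pf; rewrite /linext big_seq; elim/big_ind: _ => [|g h|S /pf <-].
- exact: graded0.
- exact: gradedD.
exact/gradedZ/HB.
Qed.

Lemma homog_graded p q a f : linear a -> homog p a -> graded q f ->
  graded (q (+) p) (a f).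
Proof. by move=> la ha; rewrite (linear_opE la); apply: graded_linext. Qed.

Lemma homog_opzero p : homog p opzero.
Proof. by move=> S; apply: graded0. Qed.

Lemma homog_opadd p a b : homog p a -> homog p b -> homog p (opadd a b).
Proof. by move=> ha hb S; apply: gradedD; [apply: ha | apply: hb]. Qed.

Lemma homog_opscale p x a : homog p a -> homog p (opscale x a).
Proof. by move=> ha S; apply/gradedZ/ha. Qed.

Lemma homog_comp p q a b : linear a -> homog p a -> homog q b ->
  homog (p (+) q) (a \o b).
Proof.
move=> la ha hb S; have := homog_graded la ha (hb S : graded _ _).
by rewrite -addbA [q (+) p]addbC.
Qed.

Lemma homog_supbr p q a b : linear a -> linear b -> homog p a -> homog q b ->
  homog (p (+) q) (supbr p q a b).
Proof.
move=> la lb ha hb S; rewrite /supbr -scaleNr; apply: gradedD.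
  exact: (homog_comp la ha hb).
apply: gradedZ; rewrite [p (+) q]addbC.
exact: (homog_comp lb hb ha).
Qed.

Lemma homog_opspan G p a : (forall b, G b -> homog p b) -> opspan G a -> homog p a.
Proof.
exact: opspan_minimal (@homog_opzero p) (@homog_opadd p) (@homog_opscale p).
Qed.

Lemma homog_x i : homog true (x_ i).
Proof.
move=> S; rewrite x_mon addbT; have [_|iS] := boolP (i \in S); first exact: graded0.
apply: gradedZ; have <- : parity (i |` S) = ~~ parity S by rewrite /parity cardfsU1 iS.
exact: graded_mon.
Qed.

Lemma homog_d i : homog true (d_ i).
Proof.
move=> S; rewrite d_mon addbT; have [iS|_] := boolP (i \in S); last exact: graded0.
apply: gradedZ; have <- : parity (S `\ i) = ~~ parity S.
  by rewrite /parity (cardfsD1 i S) iS /= negbK.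
exact: graded_mon.
Qed.

Lemma homog_v m : homog true (v_ m).
Proof.
move=> S; elim/(@down3_ind (maxidx (mon S)).+1): m => m.
  by move=> Sm; rewrite v_gt_maxidx //; apply: graded0.
move=> IH; rewrite v_rec; apply: gradedD; first exact: homog_d.
have := homog_graded (linearP _) (@homog_x m)
  (homog_graded (linearP _) (@homog_x m.+1) IH).
by rewrite -!addbA.
Qed.

Lemma projE p f : proj p f = linext (fun S => if parity S == p then mon S else 0) f.
Proof.
rewrite /proj /linext [LHS]big_mkcond; apply: eq_bigr => S _.
by case: eqP => // _; rewrite scaler0.
Qed.

Lemma graded_proj p f : graded p (proj p f).
Proof.
rewrite /proj; elim/big_ind: _ => [|g h|S /eqP <-]; first exact: graded0.
  exact: gradedD.
exact/gradedZ/graded_mon.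
Qed.

Lemma proj_graded p q f : graded q f -> proj p f = if p == q then f else 0.
Proof.
move=> qf; rewrite /proj big_seq_cond; case: (eqVneq p q) => [->|pq].
  rewrite [RHS]mon_sum [RHS]big_seq; apply: eq_bigl => S.
  by have [/qf ->|//] := boolP (S \in msupp f); rewrite eqxx.
rewrite big_pred0 // => S.
by have [/qf ->|//] := boolP (S \in msupp f); rewrite eq_sym (negbTE pq).
Qed.

Lemma proj_sum f : proj false f + proj true f = f.
Proof.
rewrite [RHS]mon_sum /proj [RHS](bigID (fun S => parity S == false)) /=; congr (_ + _).
by apply: eq_bigl => S; case: parity.
Qed.

Lemma linear_proj p : linear (@proj K p).
Proof. by move=> x f g; rewrite !projE linearP. Qed.

Lemma partD p a b : part p (opadd a b) = opadd (part p a) (part p b).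
Proof.
apply: functional_extensionality => f.
have projD q g h : proj q (g + h) = proj q g + proj q h by rewrite !projE linearD.
by rewrite /part /opadd !projD; apply: addrACA.
Qed.

Lemma partZ p x a : part p (opscale x a) = opscale x (part p a).
Proof.
apply: functional_extensionality => f; rewrite /part /opscale scalerDr.
by rewrite !(linear_opZ (linear_proj _)).
Qed.

Lemma part_sum a : linear a -> a = opadd (part false a) (part true a).
Proof.
move=> la; apply: functional_extensionality => f; rewrite /opadd /part addrACA.
rewrite [X in _ + X]addrC !(proj_sum (a _)) -[in LHS](proj_sum f).
by rewrite -[proj false f in LHS]scale1r la scale1r.
Qed.

Lemma part_homog p q a : linear a -> homog q a ->
  part p a = if p == q then a else opzero.
Proof.
move=> la ha; apply: functional_extensionality => f.
have a_proj r : graded (r (+) q) (a (proj r f)) := homog_graded la ha (@graded_proj r f).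
rewrite /part (proj_graded _ (a_proj false)) (proj_graded _ (a_proj true)) /=.
rewrite (inj_eq negb_inj); case: eqP => _; last exact: addr0.
rewrite -[in RHS](proj_sum f) -[proj false f in RHS]scale1r la.
by rewrite scale1r.
Qed.

(** * Brackets of pivots *)

Lemma below_le m n s : (m <= n)%N -> below m s -> below n s.
Proof. by move=> mn; apply: sub_all => j /= jm; apply: leq_trans mn. Qed.

Lemma below_iota m n k : (m + k <= n)%N -> below n (iota m k).
Proof. by move=> mkn; apply/allP => j; rewrite mem_iota /=; lia. Qed.

Fixpoint xmon s f : Lam := if s is i :: t then x_ i (xmon t f) else f.

Lemma xmon_is_linear s : linear (xmon s).
Proof. by elim: s => //= i s IH c f g; rewrite IH linearP. Qed.
HB.instance Definition _ s :=
  GRing.isLinear.Build K Lam Lam _ (xmon s) (xmon_is_linear s).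

Lemma xmon_cat s t f : xmon (s ++ t) f = xmon s (xmon t f).
Proof. by elim: s => //= i s ->. Qed.

Lemma signrS n : (-1) ^+ n.+1 = - (-1) ^+ n :> K.
Proof. by rewrite exprS mulN1r. Qed.

Lemma xmon_x j s f : xmon s (x_ j f) = (-1) ^+ size s *: x_ j (xmon s f).
Proof.
elim: s => [|i s IH] /=; first by rewrite scale1r.
by rewrite IH linearZ /= x_anticomm signrS scaleNr scalerN.
Qed.

Lemma xmonC s t f : xmon s (xmon t f) = (-1) ^+ (size s * size t) *: xmon t (xmon s f).
Proof.
elim: t f => [|j t IH] f /=; first by rewrite muln0 scale1r.
by rewrite xmon_x IH linearZ /= scalerA -exprD mulnS.
Qed.

Lemma v_xmon m s f : below m s -> v_ m (xmon s f) = (-1) ^+ size s *: xmon s (v_ m f).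
Proof.
elim: s => [|i s IH] /=; first by rewrite scale1r.
by case/andP=> im /IH IHs; rewrite (v_x_lt _ im) IHs linearZ /= signrS scaleNr.
Qed.

Lemma x_xmon_mem j s f : j \in s -> x_ j (xmon s f) = 0.
Proof.
elim: s => //= i s IH; rewrite inE => /predU1P[->|/IH js]; first exact: x_sq.
by rewrite x_anticomm js linear0 oppr0.
Qed.

Lemma xmon_x_mem j s f : j \in s -> xmon s (x_ j f) = 0.
Proof. by move=> js; rewrite xmon_x x_xmon_mem // scaler0. Qed.

Lemma xmon_nuniq s f : ~~ uniq s -> xmon s f = 0.
Proof.
elim: s => //= i s IH; rewrite negb_and negbK => /orP[si|/IH ->].
  exact: x_xmon_mem.
exact: linear0.
Qed.

Lemma xmon_perm s t : perm_eq s t ->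
  exists e : nat, forall f, xmon s f = (-1) ^+ e *: xmon t f.
Proof.
elim: s t => [|i s IH] t.
  by move=> /perm_size /esym /size0nil ->; exists 0%N => f; rewrite scale1r.
move=> pst; have it : i \in t by rewrite -(perm_mem pst) mem_head.
case/splitPr: it pst => t1 t2 pst.
have {pst} : perm_eq s (t1 ++ t2).
  by rewrite -(perm_cons i) (perm_trans pst) //; apply/permEl/(perm_catCA t1 [:: i]).
move=> /IH[e st]; exists (e + size t1)%N => f /=.
rewrite st linearZ /= !xmon_cat /= xmon_x scalerA exprD -mulrA -expr2.
by rewrite sqrr_sign mulr1.
Qed.

Definition xpivot s m : Op := xmon s \o v_ m.

Lemma linear_xpivot s m : linear (xpivot s m).
Proof. exact: linear_comp (xmon_is_linear s) (linearP (v_ m)). Qed.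

Definition pivot_xmon_br m t : Op := supbr true (odd (size t)) (v_ m) (xmon t).
Definition pivot_br m n : Op := supbr true true (v_ m) (v_ n).

Lemma pivot_xmon_brE m t f :
  pivot_xmon_br m t f = v_ m (xmon t f) - (-1) ^+ size t *: xmon t (v_ m f).
Proof. by rewrite /pivot_xmon_br /supbr signr_odd. Qed.

Lemma pivot_x_brE m j f : pivot_xmon_br m [:: j] f = v_ m (x_ j f) + x_ j (v_ m f).
Proof. by rewrite pivot_xmon_brE scaleN1r opprK. Qed.

Lemma pivot_brE m n f : pivot_br m n f = v_ m (v_ n f) + v_ n (v_ m f).
Proof. by rewrite /pivot_br /supbr scaleN1r opprK. Qed.

Lemma pivot_xmon_br_below m t f : below m t -> pivot_xmon_br m t f = 0.
Proof. by move=> tm; rewrite pivot_xmon_brE v_xmon // subrr. Qed.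

Lemma pivot_xmon_br_cons m j t f :
  pivot_xmon_br m (j :: t) f =
  pivot_xmon_br m [:: j] (xmon t f) - x_ j (pivot_xmon_br m t f).
Proof.
rewrite pivot_x_brE !pivot_xmon_brE /= signrS scaleNr opprK linearB linearZ /=.
by rewrite opprB [X in _ = _ + X]addrC addrA addrK.
Qed.

Lemma xx_x i j k f : x_ i (x_ j (x_ k f)) = x_ k (x_ i (x_ j f)).
Proof. by rewrite (x_anticomm j k) linearN (x_anticomm i k) opprK. Qed.

Lemma v_xx_lt m i j f : (i < m)%N -> (j < m)%N ->
  v_ m (x_ i (x_ j f)) = x_ i (x_ j (v_ m f)).
Proof. by move=> im jm; rewrite !v_x_lt // linearN opprK. Qed.

Lemma pivot_x_br_id m f : pivot_xmon_br m [:: m] f = f.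
Proof.
rewrite pivot_x_brE (v_rec m (x_ m f)) (v_rec m f) d_x v_x_lt; last by lia.
rewrite !linearN linearD /= x_sq addr0 xx_x x_sq oppr0 addr0.
by rewrite subrK.
Qed.

Lemma pivot_x_br_gt m j f : (m < j)%N ->
  pivot_xmon_br m [:: j] f = x_ m (x_ m.+1 (pivot_xmon_br m.+3 [:: j] f)).
Proof.
move=> mj; rewrite !pivot_x_brE (v_rec m (x_ j f)) (v_rec m f) d_x_neq; last by lia.
by rewrite !linearD /= addrACA addNr add0r (xx_x m m.+1 j).
Qed.

Lemma x_pivot_x_br j i f : i != j -> x_ j (pivot_xmon_br j [:: i] f) = 0.
Proof.
rewrite neq_ltn => /orP[ij|ji]; last by rewrite pivot_x_br_gt // x_sq.
by rewrite pivot_xmon_br_below ?linear0 //= ij.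
Qed.

Lemma x_pivot_xmon_br j t f : j \notin t -> x_ j (pivot_xmon_br j t f) = 0.
Proof.
elim: t f => [|i t IH] f; first by rewrite pivot_xmon_br_below ?linear0.
rewrite inE negb_or => /andP[ji jt].
rewrite pivot_xmon_br_cons linearB /= x_pivot_x_br 1?eq_sym //.
by rewrite x_anticomm IH // linear0 oppr0 subr0.
Qed.

Lemma v_sq m f : v_ m (v_ m f) = x_ m.+1 (v_ m.+3 f).
Proof.
have dv : d_ m (v_ m f) = x_ m.+1 (v_ m.+3 f) + x_ m (x_ m.+1 (d_ m (v_ m.+3 f))).
  rewrite (v_rec m) linearD /= d_sq add0r d_x d_x_neq; last by lia.
  by rewrite linearN opprK.
have vv : v_ m.+3 (v_ m f) = - d_ m (v_ m.+3 f) + x_ m (x_ m.+1 (v_ m.+3 (v_ m.+3 f))).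
  by rewrite (v_rec m f) linearD /= v_d_lt ?v_xx_lt //; lia.
rewrite (v_rec m (v_ m f)) dv vv !linearD !linearN /= (xx_x m m.+1 m) x_sq addr0.
by rewrite addrK.
Qed.

Lemma pivot_brC m n f : pivot_br m n f = pivot_br n m f.
Proof. by rewrite !pivot_brE addrC. Qed.

Lemma pivot_br_id m f : pivot_br m m f = 2%:R *: x_ m.+1 (v_ m.+3 f).
Proof. by rewrite pivot_brE v_sq scaler_nat mulr2n. Qed.

Lemma pivot_br_far m n f : (m.+1 < n)%N ->
  pivot_br m n f = x_ m (x_ m.+1 (pivot_br m.+3 n f)).
Proof.
move=> mn; rewrite !pivot_brE [v_ m (v_ n f)]v_rec [v_ m f]v_rec !linearD /=.
by rewrite v_d_lt ?v_xx_lt //; try lia; rewrite addrACA subrr add0r.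
Qed.

Lemma x_pivot_br m n f : (m.+1 < n)%N -> x_ m (pivot_br m n f) = 0.
Proof. by move=> mn; rewrite pivot_br_far // x_sq. Qed.

Lemma pivot_br_next m f : pivot_br m m.+1 f = - xpivot [:: m] m.+3 f.
Proof.
have vx : v_ m.+1 (x_ m.+1 (v_ m.+3 f)) = v_ m.+3 f - x_ m.+1 (v_ m.+1 (v_ m.+3 f)).
  by apply/eqP; rewrite -subr_eq opprK -pivot_x_brE pivot_x_br_id.
rewrite pivot_brE [v_ m (v_ _ f)]v_rec [v_ m f]v_rec linearD /= v_d_lt // v_x_lt // vx.
rewrite addrACA subrr add0r linearB /= opprB addrA -!linearD /=.
by rewrite -pivot_brE pivot_brC x_pivot_br // linear0 add0r.
Qed.

Lemma pivot_br_next2 m f : pivot_br m m.+2 f = - xpivot [:: m; m.+1; m.+2] m.+2.+3 f.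
Proof. by rewrite pivot_br_far // pivot_brC pivot_br_next !linearN. Qed.

Lemma pivot_br_cases m n : (m <= n)%N ->
  (exists k l, [/\ (n <= k)%N, odd (size l), below k l &
     forall f, pivot_br m n f = - xpivot l k.+2 f]) \/
  (exists l, [/\ ~~ odd (size l), below n.-1 l &
     forall f, pivot_br m n f = 2%:R *: xpivot (n.+1 :: l) n.+3 f]).
Proof.
have [d] := ubnP (n - m)%N; elim: d m => // d IH m le_d.
rewrite leq_eqVlt => /predU1P[<-|].
  by right; exists [::]; split=> // f; rewrite pivot_br_id.
rewrite leq_eqVlt => /predU1P[<-|mn].
  by left; exists m.+1, [:: m]; split=> [|||f]; rewrite /= ?ltnSn ?pivot_br_next.
have [mn3|n_m3] := leqP m.+3 n; last first.
  have <- : m.+2 = n by lia.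
  left; exists m.+3, [:: m; m.+1; m.+2]; split=> // [|f]; first by rewrite /=; lia.
  exact: pivot_br_next2.
have [|//|[k [l [nk ol lk br]]]|[l [ol ln br]]] := IH m.+3; first by lia.
  left; exists k, [:: m, m.+1 & l]; split=> // [||f]; first by rewrite /= negbK.
    by rewrite /= lk !andbT; lia.
  by rewrite pivot_br_far // br !linearN.
right; exists [:: m, m.+1 & l]; split=> [||f]; first by rewrite /= negbK.
  by rewrite /= ln andbT; lia.
by rewrite pivot_br_far // br !linearZ /xpivot /= xx_x.
Qed.

Lemma homog_xmon s : homog (odd (size s)) (xmon s).
Proof.
elim: s => [|i s IH]; first by move=> S; rewrite addbF; apply: graded_mon.
exact: (homog_comp (linearP (x_ i)) (@homog_x i) IH).
Qed.

Lemma homog_xpivot s m : homog (~~ odd (size s)) (xpivot s m).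
Proof. by rewrite -addbT; apply: homog_comp (linearP _) (@homog_xmon s) (@homog_v m). Qed.

Lemma supbr_xmon s t f : supbr (odd (size s)) (odd (size t)) (xmon s) (xmon t) f = 0.
Proof. by rewrite /supbr xmonC -oddM signr_odd subrr. Qed.

Lemma supbr_xmon_v s m f : below m s -> supbr (odd (size s)) true (xmon s) (v_ m) f = 0.
Proof. by move=> sm; rewrite supbrC [X in _ *: X]pivot_xmon_br_below // scaler0. Qed.

(** * Multiplications by elements of the Grassmann algebra *)

Definition xmon_span B p :=
  opspan (fun a => exists s, [/\ below B s, odd (size s) = p & a = xmon s]).

Lemma mem_xmon_span B p s : below B s -> odd (size s) = p -> xmon_span B p (xmon s).
Proof. by move=> sB sp; apply: mem_opspan; exists s. Qed.

Lemma xmon_span_linear B p a : xmon_span B p a -> linear a.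
Proof. by apply: opspan_linear => _ [s [_ _ ->]]; apply: linearP. Qed.

Lemma xmon_span_homog B p a : xmon_span B p a -> homog p a.
Proof. by apply: homog_opspan => _ [s [_ <- ->]]; apply: homog_xmon. Qed.

Lemma xmon_span_le B B' p a : (B <= B')%N -> xmon_span B p a -> xmon_span B' p a.
Proof.
move=> BB'; apply: sub_opspan => _ [s [sB sp ->]].
exact: mem_xmon_span (below_le BB' sB) sp.
Qed.

Lemma xmon_span_comp B p q a b : xmon_span B p a -> xmon_span B q b ->
  xmon_span B (p (+) q) (a \o b).
Proof.
move=> Sa Sb; apply: (opspan_comp (b := id) (c := b)) Sa => // _ [s [sB <- ->]].
apply: (opspan_comp (b := xmon s) (c := id)) Sb => [|_ [t [tB <- ->]]].
  exact: linearP.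
apply: transport_op (mem_xmon_span (s := s ++ t) _ _) => [f||].
- exact: xmon_cat.
- by rewrite all_cat sB.
by rewrite size_cat oddD.
Qed.

Lemma xmon_span_supbr B B' p q a b f : xmon_span B p a -> xmon_span B' q b ->
  supbr p q a b f = 0.
Proof.
move=> Sa Sb; have lb := xmon_span_linear Sb; move: f.
apply: (opspan_supbr_eq0 (b := id)) Sa => // _ [s [_ <- ->]] f; rewrite supbrC.
have -> : supbr q (odd (size s)) b (xmon s) f = 0; last exact: scaler0.
move: f; apply: (opspan_supbr_eq0 (b := id)) Sb => // [|_ [t [_ <- ->]] f].
  exact: linearP.
exact: supbr_xmon.
Qed.

Lemma xmon_span_supbr_v B m p a f : (B <= m)%N -> xmon_span B p a ->
  supbr p true a (v_ m) f = 0.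
Proof.
move=> Bm Sa; move: f; apply: (opspan_supbr_eq0 (b := id)) Sa => // [|_ [s [sB <- ->]] f].
  exact: linearP.
exact/supbr_xmon_v/(below_le Bm).
Qed.

(* Expand by the Leibniz rule in both arguments: a supercommutes with b, and with v_n
   because its generators are below n. *)
Lemma xmon_span_pivot_br B m n p q a b f : xmon_span n p a -> xmon_span B q b ->
  supbr (p (+) true) (q (+) true) (a \o v_ m) (b \o v_ n) f =
  a (supbr true q (v_ m) b (v_ n f)) + (-1) ^+ q *: a (b (pivot_br m n f)).
Proof.
move=> Sa Sb; have la := xmon_span_linear Sa; have lb := xmon_span_linear Sb.
rewrite (supbr_compl la) -[RHS]addr0; apply: (congr2 +%R); last first.
  rewrite (supbr_compr lb) (xmon_span_supbr _ Sa Sb).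
  by rewrite (xmon_span_supbr_v _ (leqnn n) Sa) (linear_op0 lb) scaler0 addr0 scaler0.
rewrite (supbr_compr lb) -[in LHS](scale1r (supbr _ _ _ _ _)) la scale1r.
by rewrite (linear_opZ la).
Qed.

Lemma pivot_x_br_span m j : xmon_span j false (pivot_xmon_br m [:: j]).
Proof.
have [d] := ubnP (j - m)%N; elim: d m => // d IH m le_d.
have [jm|mj|->] := ltngtP j m.
- apply: transport_op (opspan0 _) => f.
  by rewrite pivot_xmon_br_below //= jm.
- have [j3|mj3] := ltnP j m.+3.
    apply: transport_op (opspan0 _) => f; rewrite pivot_x_br_gt //.
    by rewrite pivot_xmon_br_below ?linear0 ?linear0 //= j3.
  have xx : xmon_span j false (xmon [:: m; m.+1]).
    by apply: mem_xmon_span => //=; lia.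
  apply: transport_op (xmon_span_comp xx (IH m.+3 _)) => [f|]; last by lia.
  by rewrite pivot_x_br_gt.
apply: transport_op (mem_xmon_span (s := [::]) _ _) => // f.
by rewrite pivot_x_br_id.
Qed.

Lemma pivot_xmon_br_span m B t : below B t ->
  xmon_span B (~~ odd (size t)) (pivot_xmon_br m t).
Proof.
elim: t => [_|j t IH /= /andP[jB tB]].
  by apply: transport_op (opspan0 _) => f; rewrite pivot_xmon_br_below.
have Sj := xmon_span_le (ltnW jB) (pivot_x_br_span m j).
have Sjt := xmon_span_comp Sj (mem_xmon_span tB (erefl _)).
have Sx : xmon_span B true (xmon [:: j]) by apply: mem_xmon_span; rewrite /= ?jB.
have /(opspanZ (-1)) := xmon_span_comp Sx (IH tB).
rewrite addTb !negbK => /(opspanD Sjt); apply: transport_op => f.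
by rewrite pivot_xmon_br_cons -scaleN1r.
Qed.

(** * Monomials spanning Q *)

(* In characteristic 2, x_{m+1} x_s v_{m+3} is not in Q unless s is empty, hence the
   factor 2 in [high_monomial]. *)
Inductive Qmonomial : bool -> nat -> Op -> Prop :=
  | low_monomial s m : below (m - 2) s -> Qmonomial (~~ odd (size s)) m (xpivot s m)
  | high_monomial s m : below m.-1 s ->
      Qmonomial (odd (size s)) m.+3 (opscale 2%:R (xpivot (m.+1 :: s) m.+3))
  | square_monomial m : Qmonomial false m.+3 (xpivot [:: m.+1] m.+3).

Definition Qspan p := opspan (fun a => exists m, Qmonomial p m a).

Lemma Qmonomial_xpivot p m a : Qmonomial p m a -> exists x s,
  [/\ below m.-1 s, p = ~~ odd (size s) & a = opscale x (xpivot s m)].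
Proof.
case=> {p m a} [s m sm|s m sm|m].
- exists 1, s; split=> //; first by apply: below_le sm; lia.
  by apply: functional_extensionality => f; rewrite /opscale scale1r.
- exists 2%:R, (m.+1 :: s); split; rewrite //= ?negbK //.
  by rewrite ltnSn; apply: below_le sm; lia.
exists 1, [:: m.+1]; split; rewrite //= ?ltnSn //.
by apply: functional_extensionality => f; rewrite /opscale scale1r.
Qed.

Lemma Qmonomial_linear p m a : Qmonomial p m a -> linear a.
Proof. by case/Qmonomial_xpivot=> c [s [_ _ ->]]; apply/linear_opscale/linear_xpivot. Qed.

Lemma Qspan_linear p a : Qspan p a -> linear a.
Proof. by apply: opspan_linear => b [m /Qmonomial_linear]. Qed.

Lemma Qspan_homog p a : Qspan p a -> homog p a.
Proof.
apply: homog_opspan => b [m /Qmonomial_xpivot[c [s [_ -> ->]]]].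
exact/homog_opscale/homog_xpivot.
Qed.

Lemma Qspan_monomial p m a : Qmonomial p m a -> Qspan p a.
Proof. by move=> Qa; apply: mem_opspan; exists m. Qed.

Lemma Qspan_low p s m : below (m - 2) s -> ~~ odd (size s) = p -> Qspan p (xpivot s m).
Proof. by move=> sm <-; apply/Qspan_monomial/low_monomial. Qed.

Lemma Qspan_high p s m : below m.-1 s -> odd (size s) = p ->
  Qspan p (opscale 2%:R (xpivot (m.+1 :: s) m.+3)).
Proof. by move=> sm <-; apply/Qspan_monomial/high_monomial. Qed.

Lemma Qspan_low_span p q s t n a : below (n - 2) s -> below (n - 2) t ->
  xmon_span (n - 2)%N q a -> ~~ (odd (size s) (+) q (+) odd (size t)) = p ->
  Qspan p (xmon s \o a \o xpivot t n).
Proof.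
move=> sn tn Sa <-; apply: opspan_comp Sa => [|_ [l [ln <- ->]]]; first exact: linearP.
apply: transport_op (Qspan_low (s := s ++ l ++ t) (m := n) _ _) => [f||].
- by rewrite /xpivot /= !xmon_cat.
- by rewrite !all_cat sn ln.
by rewrite !size_cat !oddD addbA.
Qed.

Lemma Qspan_high_span p q s n a : below n.-1 s -> xmon_span n.-1 q a ->
  odd (size s) (+) q = p ->
  Qspan p (opscale 2%:R (xmon s \o x_ n.+1) \o a \o v_ n.+3).
Proof.
move=> sn Sa <-; apply: opspan_comp Sa => [|_ [l [ln <- ->]]].
  exact/linear_opscale/linear_comp/linearP/linearP.
apply: transport_op (opspanZ ((-1) ^+ size s) (Qspan_high (s := s ++ l) (m := n) _ _)).
- by move=> f; rewrite /opscale /xpivot /= xmon_x xmon_cat !scalerA mulrC.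
- by rewrite all_cat sn.
by rewrite size_cat oddD.
Qed.

Lemma xpivot_br m n s t f : below n s ->
  supbr (~~ odd (size s)) (~~ odd (size t)) (xpivot s m) (xpivot t n) f =
  xmon s (pivot_xmon_br m t (v_ n f)) +
  (-1) ^+ size t *: xmon s (xmon t (pivot_br m n f)).
Proof.
move=> sn; have Ss := mem_xmon_span sn (erefl _).
have St : xmon_span (\max_(j <- t) j).+1 (odd (size t)) (xmon t).
  by apply: mem_xmon_span => //; apply/allP => j jt; rewrite /= ltnS leq_bigmax_seq.
by rewrite -!addbT (xmon_span_pivot_br m f Ss St) signr_odd.
Qed.

Lemma Qspan_pivot_br m n s : (m <= n)%N -> below n.-1 s ->
  Qspan (odd (size s)) (xmon s \o pivot_br m n).
Proof.
case/pivot_br_cases=> [[k [l [nk ol lk br]]]|[l [ol ln br]]] sn.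
  have Qsl : Qspan (odd (size s)) (xpivot (s ++ l) k.+2).
    apply: Qspan_low; last by rewrite size_cat oddD ol addbT negbK.
    by rewrite all_cat subn2 /= lk andbT; apply: below_le sn; lia.
  apply: transport_op (opspanZ (-1) Qsl) => f.
  by rewrite /opscale /xpivot /= br linearN scaleN1r xmon_cat.
have Qsl : Qspan (odd (size s)) (opscale 2%:R (xpivot (n.+1 :: s ++ l) n.+3)).
  by apply: Qspan_high; rewrite ?all_cat ?sn // size_cat oddD (negbTE ol) addbF.
apply: transport_op (opspanZ ((-1) ^+ size s) Qsl) => f.
rewrite /opscale /= br [in RHS]linearZ /xpivot /= xmon_x xmon_cat !scalerA.
by rewrite mulrC.
Qed.

Lemma Qspan_xpivot_br m n s t : (m <= n)%N -> below m.-1 s -> below n.-1 t ->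
  Qspan (~~ odd (size s) (+) ~~ odd (size t)) (xmon s \o pivot_xmon_br m t \o v_ n) ->
  Qspan (~~ odd (size s) (+) ~~ odd (size t))
    (supbr (~~ odd (size s)) (~~ odd (size t)) (xpivot s m) (xpivot t n)).
Proof.
move=> mn sm tn Qst; have st : below n.-1 (s ++ t).
  by rewrite all_cat tn andbT; apply: below_le sm; lia.
have Qbr := opspanZ ((-1) ^+ size t) (Qspan_pivot_br mn st).
move: Qst; rewrite addNb addbN negbK -oddD -size_cat => Qst.
apply: transport_op (opspanD Qst Qbr) => f.
rewrite xpivot_br; last by apply: below_le sm; lia.
by rewrite /opadd /opscale /= xmon_cat.
Qed.

Lemma Qspan_pivot_xmon_br m n s t : (m <= n)%N -> below m.-1 s -> below (n - 2) t ->
  Qspan (~~ odd (size s) (+) ~~ odd (size t)) (xmon s \o pivot_xmon_br m t \o v_ n).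
Proof.
move=> mn sm tn; have [nm|mn2] := leqP n m.+2.
  apply: transport_op (opspan0 _) => f.
  by rewrite /= pivot_xmon_br_below ?linear0 //; apply: below_le tn; lia.
apply: (Qspan_low_span (t := [::]) _ _ (pivot_xmon_br_span m tn)) => //.
  by apply: below_le sm; lia.
by rewrite addbF addNb.
Qed.

Lemma Qspan_pivot_x_br m n s t : below m.-1 s -> below n.+1 t ->
  Qspan (~~ odd (size s) (+) odd (size t))
    (xmon s \o pivot_xmon_br m [:: n.+1] \o xpivot t n.+3).
Proof.
move=> sm tn; have [nm|mn1] := ltnP n.+1 m.
  apply: transport_op (opspan0 _) => f.
  by rewrite /= pivot_xmon_br_below ?linear0 //= nm.
apply: (Qspan_low_span (n := n.+3)) (pivot_x_br_span m n.+1) _; rewrite ?subn2 //=.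
  by apply: below_le sm; lia.
by rewrite addbF addNb.
Qed.

Lemma Qspan_x_pivot_xmon_br m n s t : below m.-1 s -> below n.-1 t ->
  Qspan (~~ odd (size s) (+) odd (size t))
    (opscale 2%:R (xmon s \o x_ n.+1) \o pivot_xmon_br m t \o v_ n.+3).
Proof.
move=> sm tn; have [nm|mn2] := leqP n m.+1.
  apply: transport_op (opspan0 _) => f; rewrite /= pivot_xmon_br_below.
    by rewrite /opscale /= !linear0.
  by apply: below_le tn; lia.
apply: Qspan_high_span (pivot_xmon_br_span m tn) _; first by apply: below_le sm; lia.
by rewrite addbN addNb.
Qed.

Lemma Qspan_br_low m n s t : (m <= n)%N -> below m.-1 s -> below (n - 2) t ->
  Qspan (~~ odd (size s) (+) ~~ odd (size t))
    (supbr (~~ odd (size s)) (~~ odd (size t)) (xpivot s m) (xpivot t n)).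
Proof.
move=> mn sm tn; apply: Qspan_xpivot_br (Qspan_pivot_xmon_br mn sm tn) => //.
by apply: below_le tn; lia.
Qed.

Lemma Qspan_br_square m n s : (m <= n.+3)%N -> below m.-1 s ->
  Qspan (~~ odd (size s) (+) false)
    (supbr (~~ odd (size s)) false (xpivot s m) (xpivot [:: n.+1] n.+3)).
Proof.
move=> mn sm.
apply: (Qspan_xpivot_br (t := [:: n.+1])) (Qspan_pivot_x_br (t := [::]) sm _) => //=.
by rewrite ltnSn.
Qed.

Lemma Qspan_br_high m n s t : (m <= n.+3)%N -> below m.-1 s -> below n.-1 t ->
  Qspan (~~ odd (size s) (+) odd (size t))
    (opscale 2%:R (supbr (~~ odd (size s)) (odd (size t)) (xpivot s m)
       (xpivot (n.+1 :: t) n.+3))).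
Proof.
move=> mn sm tn; have sn : below n.+3 s by apply: below_le sm; lia.
have stn : below n.+2 (s ++ n.+1 :: t).
  rewrite all_cat /= ltnSn; apply/andP; split; first by apply: below_le sm; lia.
  by apply: below_le tn; lia.
have := opspanZ (2%:R * (-1) ^+ size (n.+1 :: t)) (Qspan_pivot_br mn stn).
rewrite size_cat oddD /= addbN -addNb => Qbr.
have Qx := opspanZ 2%:R (Qspan_pivot_x_br sm (below_le (leqW (leq_pred n)) tn)).
have Qxt := opspanZ (-1) (Qspan_x_pivot_xmon_br sm tn).
apply: transport_op (opspanD (opspanD Qx Qxt) Qbr) => f.
have := xpivot_br m (n.+1 :: t) f sn; rewrite /= negbK /opadd /opscale => ->.
rewrite pivot_xmon_br_cons (linearB (xmon s)) /= xmon_cat.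
by rewrite scalerDr scalerBr scaleN1r scalerA.
Qed.

Lemma Qspan_br_monomial m n p q a b : Qmonomial p m a -> Qmonomial q n b ->
  Qspan (p (+) q) (supbr p q a b).
Proof.
wlog mn : p q m n a b / (m <= n)%N => [le_case Qa Qb|Qa Qb].
  have [mn|/ltnW nm] := leqP m n; first exact: le_case mn Qa Qb.
  rewrite addbC; apply: transport_op (opspanZ _ (le_case _ _ _ _ _ _ nm Qb Qa)) => f.
  exact/esym/supbrC.
have [c [s [sm -> ->]]] := Qmonomial_xpivot Qa; have lb := Qmonomial_linear Qb.
have {Qa} : Qspan (~~ odd (size s) (+) q) (supbr (~~ odd (size s)) q (xpivot s m) b).
  case: Qb mn {lb} => {q n b} [t n tn|t n tn|n] mn.
  - exact: Qspan_br_low.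
  - apply: transport_op (Qspan_br_high mn sm tn) => f.
    rewrite /supbr /opscale (linear_opZ (linear_xpivot s m)) scalerBr !scalerA.
    by rewrite mulrC.
  exact: Qspan_br_square.
move=> /(opspanZ c); apply: transport_op => f.
by rewrite /supbr /opscale (linear_opZ lb) scalerBr !scalerA mulrC.
Qed.

Lemma Qspan_supbr p q a b : Qspan p a -> Qspan q b -> Qspan (p (+) q) (supbr p q a b).
Proof.
apply: opspan_supbr => [c [m /Qmonomial_linear]|c [m /Qmonomial_linear]|c d] //.
by move=> [m Qc] [n Qd]; apply: Qspan_br_monomial Qc Qd.
Qed.

Lemma xpivot_sq0 s m f : below m s -> s != [::] -> xpivot s m (xpivot s m f) = 0.
Proof.
move=> sm s0; rewrite /xpivot /= v_xmon // linearZ /= -xmon_cat xmon_nuniq ?scaler0 //.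
by case: s s0 {sm} => //= i s _; rewrite mem_cat mem_head orbT.
Qed.

Lemma Qspan_sq_monomial m a : Qmonomial true m a -> Qspan false (opsq a).
Proof.
case/Qmonomial_xpivot=> c [[|i s] [sm _ ->]].
  apply: transport_op (opspanZ (c * c) (Qspan_monomial (square_monomial m))) => f.
  by rewrite /opsq /opscale /xpivot /= linearZ /= v_sq scalerA.
apply: transport_op (opspan0 _) => f.
rewrite /opsq /opscale (linear_opZ (linear_xpivot _ _)) xpivot_sq0 ?scaler0 //.
by apply: below_le sm; lia.
Qed.

Lemma Qspan_sq a : Qspan true a -> Qspan false (opsq a).
Proof.
elim=> [|c b d [m Qb] Qd IH]; first exact: opspan0.
have lb := Qmonomial_linear Qb; have ld := Qspan_linear Qd.
have Qbd := Qspan_supbr (Qspan_monomial Qb) Qd.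
have Qbb := Qspan_sq_monomial Qb.
apply: transport_op (opspanD (opspanD (opspanZ (c * c) Qbb) (opspanZ c Qbd)) IH) => f.
rewrite /opadd /opscale /opsq /supbr lb ld expr1 scaleN1r opprK !scalerDr !scalerA.
by rewrite [RHS]addrA; apply: (congr1 (+%R^~ _)); apply: addrA.
Qed.

Lemma inQ_linear a : inQ a -> linear a.
Proof.
elim=> {a} [i _||a b _ la _ lb|c a _ la|p q a b _ la _ lb _ _|a _ la _].
- exact: linearP.
- by move=> x f g; rewrite /opzero scaler0 addr0.
- exact: linear_opadd.
- exact: linear_opscale.
- exact: linear_supbr.
exact: (linear_comp la la).
Qed.

Lemma inQ_v_lt3 m : (m < 3)%N -> inQ (v_ m).
Proof. by move=> m3; apply: transport_op (inQ_gen K m3) => f; rewrite v_E. Qed.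

Lemma inQ_part p a : inQ a -> inQ (part p a) /\ Qspan p (part p a).
Proof.
move=> Qa; elim: Qa p => {a} [i i3||a b _ IHa _ IHb|c a _ IHa
  |q r a b Qa IHa Qb IHb ha hb|a Qa IHa ha] p.
- have -> : @pivot K i = v_ i by apply: functional_extensionality => f; rewrite v_E.
  rewrite (part_homog _ (linearP _) (@homog_v i)); case: p; split.
  + exact: inQ_v_lt3.
  + exact: (Qspan_low (s := [::])).
  + exact: inQ_zero.
  exact: opspan0.
- rewrite (part_homog _ (inQ_linear (inQ_zero K)) (@homog_opzero p)) if_same.
  by split; [exact: inQ_zero | exact: opspan0].
- have [[Qa Ha] [Qb Hb]] := conj (IHa p) (IHb p).
  by rewrite partD; split; [exact: inQ_add Qa Qb | exact: opspanD Ha Hb].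
- have [Qa Ha] := IHa p.
  by rewrite partZ; split; [exact: inQ_scale Qa | exact: opspanZ Ha].
- have la := inQ_linear Qa; have lb := inQ_linear Qb.
  have [_] := IHa q; rewrite (part_homog _ la ha) eqxx => Ha.
  have [_] := IHb r; rewrite (part_homog _ lb hb) eqxx => Hb.
  rewrite (part_homog _ (linear_supbr _ _ la lb) (homog_supbr la lb ha hb)).
  case: eqP => [->|_]; last by split; [exact: inQ_zero | exact: opspan0].
  by split; [exact: inQ_br Qa Qb ha hb | exact: Qspan_supbr Ha Hb].
have la := inQ_linear Qa; have [_] := IHa true; rewrite (part_homog _ la ha) eqxx => Ha.
rewrite (part_homog _ (linear_comp la la) (homog_comp la ha ha)).
case: eqP => [->|_]; last by split; [exact: inQ_zero | exact: opspan0].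
by split; [exact: inQ_sq Qa ha | exact: Qspan_sq Ha].
Qed.

Lemma inQ_ideal : Q_ideal inQ.
Proof.
split; first by [].
split; first exact: inQ_zero.
split; first exact: inQ_add.
split; first exact: inQ_scale.
split; first by move=> p a /(inQ_part p)[].
split; last exact: inQ_sq.
by move=> p r q a Qq Qa hq ha; exact: inQ_br Qq Qa hq ha.
Qed.

(** * Monomials in ideals of Q *)

Section IdealClosure.
Variable I : Op -> Prop.
Hypothesis I_ideal : Q_ideal I.

Lemma ideal_inQ a : I a -> inQ a.
Proof. by case: I_ideal => + _; apply. Qed.

Lemma ideal0 : I opzero.
Proof. by case: I_ideal => _ []. Qed.

Lemma idealD a b : I a -> I b -> I (opadd a b).
Proof. by case: I_ideal => _ [_ [+ _]]; apply. Qed.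

Lemma idealZ x a : I a -> I (opscale x a).
Proof. by case: I_ideal => _ [_ [_ [+ _]]]; apply. Qed.

Lemma ideal_part p a : I a -> I (part p a).
Proof. by case: I_ideal => _ [_ [_ [_ [+ _]]]]; apply. Qed.

Lemma ideal_supbrr p q a b : inQ a -> I b -> homog p a -> homog q b -> I (supbr p q a b).
Proof. by case: I_ideal => _ [_ [_ [_ [_ [+ _]]]]]; apply. Qed.

Lemma ideal_sq a : I a -> homog true a -> I (opsq a).
Proof. by case: I_ideal => _ [_ [_ [_ [_ [_ +]]]]]; apply. Qed.

Lemma ideal_supbrl p q a b : I a -> inQ b -> homog p a -> homog q b -> I (supbr p q a b).
Proof.
move=> Ia Qb ha hb; apply: transport_op (idealZ _ (ideal_supbrr Qb Ia hb ha)) => f.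
exact/esym/supbrC.
Qed.

Lemma ideal_unscale x a : x != 0 -> I (opscale x a) -> I a.
Proof.
move=> x0 /(idealZ x^-1); apply: transport_op => f.
by rewrite /opscale scalerA mulVf // scale1r.
Qed.

Lemma ideal_sign n a : I (opscale ((-1) ^+ n) a) -> I a.
Proof. by apply: ideal_unscale; rewrite signr_eq0. Qed.

Lemma ideal_xmon_perm s t a : perm_eq s t -> I (xmon s \o a) -> I (xmon t \o a).
Proof.
move=> /xmon_perm[e st] Is; apply: (ideal_sign (n := e)).
by apply: transport_op Is => f; rewrite /= st.
Qed.

Lemma ideal_xpivot_nuniq s m : ~~ uniq s -> I (xpivot s m).
Proof. by move=> us; apply: transport_op ideal0 => f; rewrite /xpivot /= xmon_nuniq. Qed.

Lemma ideal_v_sq m : I (v_ m) -> I (xpivot [:: m.+1] m.+3).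
Proof. by move=> /ideal_sq/(_ (@homog_v m)); apply: transport_op => f; apply: v_sq. Qed.

Lemma ideal_pivot_br m n s t : below n s -> below m t ->
  I (supbr (~~ odd (size s)) (~~ odd (size t)) (xpivot s m) (xpivot t n)) ->
  I (xmon (s ++ t) \o pivot_br m n).
Proof.
move=> sn tm Ist; apply: (ideal_sign (n := size t)); apply: transport_op Ist => f.
by rewrite xpivot_br // pivot_xmon_br_below // linear0 add0r -xmon_cat.
Qed.

Lemma ideal_pivot_brr m n s t : inQ (xpivot s m) -> I (xpivot t n) ->
  below n s -> below m t -> I (xmon (s ++ t) \o pivot_br m n).
Proof.
move=> Qs It sn tm; apply: ideal_pivot_br => //.
by apply: ideal_supbrr => //; apply: homog_xpivot.
Qed.

Lemma ideal_pivot_brl m n s t : I (xpivot s m) -> inQ (xpivot t n) ->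
  below n s -> below m t -> I (xmon (s ++ t) \o pivot_br m n).
Proof.
move=> Is Qt sn tm; apply: ideal_pivot_br => //.
by apply: ideal_supbrl => //; apply: homog_xpivot.
Qed.

Lemma ideal_pivot_br_next m s : I (xmon s \o pivot_br m m.+1) ->
  I (xpivot (s ++ [:: m]) m.+3).
Proof.
move=> Is; apply: (ideal_sign (n := 1)); apply: transport_op Is => f.
by rewrite /opscale expr1 scaleN1r /xpivot /= xmon_cat pivot_br_next linearN.
Qed.

Lemma ideal_pivot_br_next2 m s : I (xmon s \o pivot_br m m.+2) ->
  I (xpivot (s ++ [:: m; m.+1; m.+2]) m.+2.+3).
Proof.
move=> Is; apply: (ideal_sign (n := 1)); apply: transport_op Is => f.
by rewrite /opscale expr1 scaleN1r /xpivot /= xmon_cat pivot_br_next2 linearN.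
Qed.

End IdealClosure.

(* The correction terms all carry a second factor x_j. *)
Lemma supbr_v_strip j s m f : j \notin s -> (j.+1 < m)%N ->
  supbr true (odd (size s)) (v_ j) (xpivot (j :: s) m) f = xpivot s m f.
Proof.
move=> js jm; rewrite -[odd _]negbK.
apply: etrans (xpivot_br (s := [::]) _ _ _ _) _ => //.
rewrite /= pivot_xmon_br_cons x_pivot_xmon_br // subr0 pivot_x_br_id.
have xx := xmonC [:: j] s (pivot_br j m f); rewrite /= in xx.
by rewrite xx x_pivot_br // linear0 !scaler0 addr0.
Qed.

Lemma inQ_v m : inQ (v_ m).
Proof.
suff: [/\ inQ (v_ m), inQ (v_ m.+1) & inQ (v_ m.+2)] by case.
elim: m => [|m [Q0 Q1 Q2]]; first by split; apply: inQ_v_lt3.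
have Qsq := ideal_v_sq inQ_ideal Q0.
split=> //; apply: transport_op (inQ_br Q1 Qsq (@homog_v _) (@homog_xpivot _ _)) => f.
exact: (supbr_v_strip (s := [::])).
Qed.

Lemma perm_iota_compl B s : uniq s -> below B s ->
  perm_eq (iota 0 B) ([seq j <- iota 0 B | j \notin s] ++ s).
Proof.
move=> us sB; apply: uniq_perm => [||j]; first exact: iota_uniq.
  rewrite cat_uniq us filter_uniq ?iota_uniq // andbT.
  by apply/hasPn => j js; rewrite mem_filter js.
rewrite mem_cat mem_filter mem_iota /=.
by have [/(allP sB) /= ->|] := boolP (j \in s); rewrite ?orbF.
Qed.

Section IdealStrip.
Variable I : Op -> Prop.
Hypothesis I_ideal : Q_ideal I.

Lemma ideal_strip t s m : uniq (t ++ s) -> below m.-1 t ->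
  I (xpivot (t ++ s) m) -> I (xpivot s m).
Proof.
elim: t => //= j t IH /andP[jts uts] /andP[jm tm] Ijts; apply: IH => //.
have := ideal_supbrr I_ideal (inQ_v j) Ijts (@homog_v j) (@homog_xpivot _ _).
apply: transport_op => f.
by rewrite /= negbK; apply: supbr_v_strip => //; lia.
Qed.

Lemma ideal_xpivot_sub n s : below n s -> I (xpivot (iota 0 n) n.+2) -> I (xpivot s n.+2).
Proof.
move=> sn In; have [us|us] := boolP (uniq s); last exact: ideal_xpivot_nuniq.
have ps := perm_iota_compl us sn.
apply: (ideal_strip (t := [seq j <- iota 0 n | j \notin s])).
- by rewrite -(perm_uniq ps) iota_uniq.
- by apply/allP => j; rewrite mem_filter mem_iota => /andP[_] /=; lia.
exact: (ideal_xmon_perm I_ideal ps In).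
Qed.

End IdealStrip.

Notation full_xpivot n := (xpivot (iota 0 n%N) n%N.+2).

Lemma inQ_pivot_br_next2 n s : below n s -> inQ (xpivot s n.+2) ->
  inQ (xpivot (s ++ [:: n; n.+1; n.+2]) n.+2.+3).
Proof.
move=> sn Qs; apply: ideal_pivot_br_next2 inQ_ideal _ _ _.
exact: (ideal_pivot_brr inQ_ideal (s := [::]) (inQ_v n) Qs).
Qed.

Lemma inQ_full_add3 n : inQ (full_xpivot n) -> inQ (full_xpivot n.+3).
Proof.
move=> Qn; rewrite -[X in iota 0 X]addn3 iotaD; apply: inQ_pivot_br_next2 Qn.
exact: below_iota.
Qed.

Lemma inQ_full8 : inQ (full_xpivot 8).
Proof.
have next m : inQ (xpivot [:: m] m.+3).
  apply: (ideal_pivot_br_next inQ_ideal (s := [::])).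
  exact: (ideal_pivot_brr inQ_ideal (s := [::]) (t := [::]) (inQ_v m) (inQ_v m.+1)).
have Q34 : inQ (xpivot [:: 3; 4]%N 7).
  apply: (ideal_strip inQ_ideal (t := [:: 1; 2]%N)) => //.
  exact: (inQ_pivot_br_next2 (s := [:: 1%N]) _ (next 1%N)).
have Q012 : inQ (full_xpivot 3) := inQ_full_add3 (n := 0) (inQ_v 2).
exact: (ideal_pivot_br_next2 inQ_ideal (ideal_pivot_brr inQ_ideal Q012 Q34 _ _)).
Qed.

Lemma inQ_full n : (5 < n)%N -> inQ (full_xpivot n).
Proof.
have Q6 : inQ (full_xpivot 6) := inQ_full_add3 (inQ_full_add3 (n := 0) (inQ_v 2)).
have Q7 : inQ (full_xpivot 7).
  apply/inQ_full_add3/inQ_full_add3.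
  apply: (ideal_pivot_br_next inQ_ideal (s := [::])).
  exact: (ideal_pivot_brr inQ_ideal (s := [::]) (t := [::]) (inQ_v 0) (inQ_v 1)).
suff full3 k : [/\ inQ (full_xpivot k.+3.+3), inQ (full_xpivot k.+4.+3) &
    inQ (full_xpivot k.+4.+4)].
  by move=> n5; have [+ _ _] := full3 (n - 6)%N; have -> : (n - 6).+3.+3 = n by lia.
elim: k => [|k [Qk6 Qk7 Qk8]]; first by split=> //; apply: inQ_full8.
by split=> //; apply: inQ_full_add3.
Qed.

Lemma inQ_xpivot n s : (5 < n)%N -> below n s -> inQ (xpivot s n.+2).
Proof. by move=> n5 sn; apply: (ideal_xpivot_sub inQ_ideal) => //; apply: inQ_full. Qed.

(** * Nonzero ideals *)

Lemma xmon_fset s : uniq s ->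
  exists e : nat, forall f, xmon s f = (-1) ^+ e *: xmon [fset j in s] f.
Proof.
move=> us; apply: xmon_perm; apply: uniq_perm => // [|j]; first exact: fset_uniq.
by rewrite in_fset.
Qed.

Lemma xmon_one s : uniq s -> exists e : nat, xmon s one = (-1) ^+ e *: mon [fset j in s].
Proof.
elim: s => [_|i s IH /= /andP[si us]].
  exists 0%N; rewrite scale1r; congr (mon _).
  by apply/fsetP => j; rewrite !inE.
have [e ->] := IH us; rewrite linearZ /= x_mon inE (negbTE si).
exists (e + count (fun j => (j < i)%N) ([fset j in s] : seq nat))%N.
rewrite scalerA /sgnb -exprD; congr (_ *: mon _).
by apply/fsetP => j; rewrite !inE.
Qed.

Lemma xmon_one_neq0 s : uniq s -> xmon s one <> 0.
Proof.
move=> /xmon_one[e ->] /(congr1 (mcoeff [fset j in s])).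
rewrite mcoeffZ mcoeff0 /mon mcoeffUU mulr1 => /eqP.
by rewrite signr_eq0.
Qed.

Lemma linear_xmon_one_neq0 a : linear a -> a <> opzero -> exists s, a (xmon s one) <> 0.
Proof.
move=> la a0; apply: NNPP => noa; apply: a0; apply: functional_extensionality.
apply: linear_mon_eq0 => // S; apply: NNPP => aS; apply: noa; exists S => aS0.
have [e oneS] := xmon_one (fset_uniq S); apply: aS.
have -> : mon S = (-1) ^+ e *: xmon S one.
  rewrite oneS scalerA -expr2 sqrr_sign scale1r; congr (mon _).
  by apply/fsetP => j; rewrite in_fset.
by rewrite (linear_opZ la) aS0 scaler0.
Qed.

Lemma v_one m : v_ m one = 0.
Proof.
elim/(@down3_ind (maxidx one).+1): m => m; first exact: v_gt_maxidx.
by move=> IH; rewrite (v_rec m) IH d_mon in_fset0 !linear0 addr0.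
Qed.

Lemma xmon_span_linext B p a : xmon_span B p a -> exists g : Lam,
  (forall S, S \in msupp g -> below B S) /\ forall f, a f = linext (xmon^~ f) g.
Proof.
elim=> [|c _ b [s [sB _ ->]] _ [g [gB bg]]].
  by exists 0; split=> [S|f]; [rewrite msupp0 | rewrite linear0].
have [us|us] := boolP (uniq s); last first.
  by exists g; split=> // f; rewrite -bg /opadd /opscale xmon_nuniq // scaler0 add0r.
have [e se] := xmon_fset us.
exists ((c * (-1) ^+ e) *: mon [fset j in s] + g); split=> [S|f]; last first.
  by rewrite linext_is_linear linext_mon -bg /opadd /opscale se scalerA.
rewrite -mcoeff_neq0 mcoeffD mcoeffZ /mon mcoeffU.
case: ([fset j in s] =P S) => [<- _|_].
  by apply/allP => j; rewrite in_fset => /(allP sB).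
by rewrite mulr0 add0r mcoeff_neq0 => /gB.
Qed.

(* Multiplying by the generators outside a smallest monomial of the support kills all the
   other monomials. *)
Lemma xmon_span_top B p a f0 : xmon_span B p a -> a f0 <> 0 -> exists t (c : K),
  [/\ below B t, c != 0 & forall f, xmon t (a f) = c *: xmon (iota 0 B) f].
Proof.
move=> Sa a0; have [g [gB ag]] := xmon_span_linext Sa.
have [S Sg minS] : exists2 S, S \in msupp g &
    forall T, T \in msupp g -> (#|` S| <= #|` T|)%N.
  have [g0|[S0 S0g]] := fset_0Vmem (msupp g).
    by case: a0; rewrite ag /linext g0 big_seq_fset0.
  case: (@arg_minnP _ [` S0g] xpredT (fun S : msupp g => #|` val S|)) => // S _ minS.
  by exists (val S) => [|T Tg]; [exact: fsvalP | exact: (minS [` Tg])].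
pose t := [seq j <- iota 0 B | j \notin S].
have [e te] := @xmon_perm _ _ (perm_iota_compl (fset_uniq S) (gB S Sg)).
exists t, (g@_S * (-1) ^+ e); split=> [||f].
- by apply/allP => j; rewrite mem_filter mem_iota => /andP[].
- by rewrite mulf_neq0 ?mcoeff_neq0 ?signr_eq0.
rewrite ag /linext (linear_sum (xmon t)) (bigD1_seq S) ?fset_uniq //=.
rewrite linearZ /= -xmon_cat te scalerA -mulrA -expr2 sqrr_sign mulr1.
rewrite big_seq_cond big1 ?addr0 // => T /andP[Tg TS].
rewrite linearZ /= -xmon_cat xmon_nuniq ?scaler0 //.
have /fsubsetPn[j jT jS] : ~~ (T `<=` S).
  by apply: contra TS => TS; rewrite eqEfcard TS minS.
rewrite cat_uniq; apply/negP => /and3P[_ /hasPn/(_ j jT) + _].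
by have := allP (gB T Tg) j jT; rewrite mem_filter jS mem_iota /= => ->.
Qed.

Definition xpivot_span N p :=
  opspan (fun a => exists s m,
    [/\ below N s, (m < N)%N, ~~ odd (size s) = p & a = xpivot s m]).

Lemma mem_xpivot_span N p s m : below N s -> (m < N)%N -> ~~ odd (size s) = p ->
  xpivot_span N p (xpivot s m).
Proof. by move=> sN mN sp; apply: mem_opspan; exists s, m. Qed.

Lemma xpivot_span_le N N' p a : (N <= N')%N -> xpivot_span N p a -> xpivot_span N' p a.
Proof.
move=> NN'; apply: sub_opspan => _ [s [m [sN mN sp ->]]].
exact: mem_xpivot_span (below_le NN' sN) (leq_trans mN NN') sp.
Qed.

Lemma Qmonomial_xpivot_span N p m a : (m < N)%N -> Qmonomial p m a -> xpivot_span N p a.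
Proof.
move=> mN /Qmonomial_xpivot[c [s [sm -> ->]]]; apply/opspanZ/mem_xpivot_span => //.
by apply: below_le sm; lia.
Qed.

Lemma Qspan_xpivot_span p a : Qspan p a -> exists N, xpivot_span N p a.
Proof.
elim=> [|c b b' [m Qb] _ [N Sb']]; first by exists 0%N; apply: opspan0.
exists (maxn N m.+1); apply: opspanD (xpivot_span_le (leq_maxl _ _) Sb').
by apply/opspanZ/(Qmonomial_xpivot_span _ Qb); rewrite leq_max ltnSn orbT.
Qed.

Lemma xpivot_span_one N p a : xpivot_span N p a -> a one = 0.
Proof.
elim=> [//|c _ b [s [m [_ _ _ ->]]] _ b0].
by rewrite /opadd /opscale /xpivot /= v_one linear0 b0 scaler0 addr0.
Qed.

Lemma xpivot_span_supbr_xmon N B p t a : (N <= B)%N -> below B t -> xpivot_span N p a ->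
  xmon_span B (p (+) odd (size t)) (supbr p (odd (size t)) a (xmon t)).
Proof.
move=> NB tB; apply: (opspan_map (F := fun a => supbr p (odd (size t)) a (xmon t))).
  by move=> x b c; apply/supbrDZl/linearP.
move=> _ [s [m [sN mN <- ->]]].
have Ss := mem_xmon_span (below_le NB sN) (erefl (odd (size s))).
move: (xmon_span_comp Ss (pivot_xmon_br_span m tB)); rewrite addbN -addNb.
apply: transport_op => f; rewrite -[in RHS]addbT (supbr_compl (linearP _)).
by rewrite supbr_xmon scaler0 addr0.
Qed.

Lemma xmon_pivot_br_eq0 N t m k f : (forall j, (N <= j < N.+3)%N -> j \in t) ->
  (m < N.+3)%N -> (N.+4 < k)%N -> xmon t (pivot_br m k f) = 0.
Proof.
move=> tN mN Nk; have [d] := ubnP (N - m)%N; elim: d m mN => // d IH m mN le_d.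
rewrite pivot_br_far; last by lia.
have [Nm|Nm] := leqP N m; first by rewrite xmon_x_mem // tN // Nm.
by rewrite !xmon_x IH ?linear0 ?scaler0 //; lia.
Qed.

(* Since x_t [a, v_k] = 0, only [a, x_t] v_k is left of [a, x_t v_k]. *)
Lemma supbr_xpivot_span N p t k a f : (forall j, (N <= j < N.+3)%N -> j \in t) ->
  (N.+4 < k)%N -> xpivot_span N p a ->
  supbr p (~~ odd (size t)) a (xpivot t k) f = supbr p (odd (size t)) a (xmon t) (v_ k f).
Proof.
move=> tN Nk Sa; rewrite -addbT (supbr_compr (xmon_is_linear t)).
have -> : xmon t (supbr p true a (v_ k) f) = 0; last by rewrite scaler0 addr0.
move: f; apply: (opspan_supbr_eq0 (b := xmon t)) Sa => [||_ [s [m [sN mN <- ->]]] f].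
- exact: linearP.
- exact: linearP.
rewrite -addbT (supbr_compl (xmon_is_linear s)).
rewrite supbr_xmon_v; last by apply: below_le sN; lia.
by rewrite scaler0 addr0 xmonC (xmon_pivot_br_eq0 f tN) ?linear0 ?scaler0 //; lia.
Qed.

Lemma xpivot_span_xmon_neq0 N k p s a : xpivot_span N p a -> below N s ->
  a (xmon s one) <> 0 -> (N.+3 <= k)%N -> exists t,
  [/\ below k t, forall j, (N <= j < N.+3)%N -> j \in t & a (xmon t one) <> 0].
Proof.
move=> Sa sN as0 Nk; pose u := iota N (k - N).
have uN j : (N <= j < N.+3)%N -> j \in u by rewrite mem_iota; lia.
have uk : below k u by apply: below_iota; lia.
have [au0|/eqP au0] := eqVneq (a (xmon u one)) 0; last by exists u.
exists (s ++ u); split=> [|j /uN ju|].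
- by rewrite all_cat uk andbT; apply: below_le sN; lia.
- by rewrite mem_cat ju orbT.
have c0 : supbr p (odd (size s)) a (xmon s) one <> 0.
  by rewrite /supbr (xpivot_span_one Sa) linear0 scaler0 subr0.
have [r [c [rN cn0 rc]]] := xmon_span_top (xpivot_span_supbr_xmon (leqnn N) sN Sa) c0.
have -> : a (xmon (s ++ u) one) = supbr p (odd (size s)) a (xmon s) (xmon u one).
  by rewrite /supbr au0 linear0 scaler0 subr0 xmon_cat.
move=> /(congr1 (xmon r)); rewrite rc linear0 -xmon_cat => /eqP.
rewrite scaler_eq0 (negbTE cn0) => /eqP; apply: xmon_one_neq0.
rewrite cat_uniq !iota_uniq andbT /=; apply/hasPn => j.
by rewrite !mem_iota /=; lia.
Qed.

Section NonzeroIdeal.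
Variable I : Op -> Prop.
Hypothesis I_ideal : Q_ideal I.

Lemma ideal_xmon_span_v n p a f0 : (5 < n)%N -> xmon_span n p a -> a f0 <> 0 ->
  I (a \o v_ n.+2) -> I (v_ n.+2.+3).
Proof.
move=> n5 Sa a0 Ia; have [t [c [tn c0 tc]]] := xmon_span_top Sa a0.
have la := xmon_span_linear Sa.
have tn2 : below n.+2 t by apply: below_le tn; lia.
have Qt : inQ (xpivot t n.+3).
  by apply: (inQ_xpivot (n := n.+1)); [exact: ltnW | exact: below_le tn].
suff: I (xpivot (iota 0 n ++ [:: n.+2]) n.+2.+3).
  rewrite -[iota 0 n ++ _]cats0 => In.
  apply: (ideal_strip I_ideal (s := [::]) _ _ In).
    by rewrite cats0 cats1 rcons_uniq iota_uniq mem_iota /=; lia.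
  by rewrite all_cat below_iota /=; lia.
apply: (ideal_pivot_br_next I_ideal).
apply: (ideal_unscale I_ideal (x := (-1) ^+ p * c)).
  by rewrite mulf_neq0 ?signr_eq0.
have ha := homog_comp la (xmon_span_homog Sa) (@homog_v n.+2).
apply: transport_op (ideal_supbrr I_ideal Qt Ia (@homog_xpivot t n.+3) ha) => f.
rewrite -addbT; apply: etrans (xmon_span_pivot_br _ _ (mem_xmon_span tn2 (erefl _)) Sa) _.
have -> : supbr true p (v_ n.+3) a (v_ n.+2 f) = 0.
  rewrite supbrC (xmon_span_supbr_v _ _ Sa) ?scaler0 //; lia.
by rewrite linear0 add0r /opscale /= -scalerA tc pivot_brC.
Qed.

Lemma ideal_v_large p a : I a -> Qspan p a -> a <> opzero ->
  exists M, forall n, (M <= n)%N -> I (v_ n).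
Proof.
move=> Ia Qa a0; have [s as0] := linear_xmon_one_neq0 (Qspan_linear Qa) a0.
have [N0 Sa0] := Qspan_xpivot_span Qa; pose N := maxn N0 (\max_(j <- s) j).+1.
have Sa : xpivot_span N p a := xpivot_span_le (leq_maxl _ _) Sa0.
have sN : below N s.
  apply/allP => j js /=; rewrite /N leq_max ltnS; apply/orP; right.
  exact: leq_bigmax_seq.
exists (N + 11)%N => n Nn; have -> : n = (n - 5).+2.+3 by lia.
have [|t [tk tN at0]] := xpivot_span_xmon_neq0 (k := (n - 5)%N) Sa sN as0; first by lia.
have Nk : (N <= n - 5)%N by lia.
apply: (ideal_xmon_span_v (f0 := one) _ (xpivot_span_supbr_xmon Nk tk Sa)); first by lia.
  by rewrite /supbr (xpivot_span_one Sa) linear0 scaler0 subr0.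
have Qt : inQ (xpivot t (n - 5).+2) by apply: inQ_xpivot => //; lia.
have It := ideal_supbrl I_ideal Ia Qt (Qspan_homog Qa) (@homog_xpivot t _).
by apply: transport_op It => f; apply: (supbr_xpivot_span _ tN _ Sa); lia.
Qed.

Variable M : nat.
Hypothesis I_v : forall n, (M <= n)%N -> I (v_ n).

Lemma ideal_low n s : (M + 9 <= n)%N -> below n s -> I (xpivot s n.+2).
Proof.
move=> Mn sn; apply: (ideal_xpivot_sub I_ideal sn).
have -> : n = (n - 3).+3 by lia.
rewrite -[X in iota 0 X]addn3 iotaD; apply: (ideal_pivot_br_next2 I_ideal).
apply: (ideal_pivot_brl I_ideal (s := [::])) => //.
- by apply: (I_v (n := (n - 3)%N)); lia.
- by apply: inQ_full; lia.
exact: below_iota.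
Qed.

Lemma ideal_high m s : (M + 17 <= m)%N -> below m.-1 s ->
  I (opscale 2%:R (xpivot (m.+1 :: s) m.+3)).
Proof.
move=> Mm sm; have [us|us] := boolP (uniq s); last first.
  by apply/(idealZ I_ideal)/(ideal_xpivot_nuniq I_ideal); rewrite /= negb_and us orbT.
suff Is : I (xmon s \o pivot_br m m).
  apply: (ideal_sign I_ideal (n := size s)); apply: transport_op Is => f.
  by rewrite /opscale /xpivot /= pivot_br_id linearZ /= xmon_x !scalerA mulrC.
have mE : (m - 2).+2 = m by lia.
have [ks|ks] := boolP ((m - 2)%N \in s).
  have pks : perm_eq ([:: (m - 2)%N] ++ rem (m - 2)%N s) s.
    by rewrite perm_sym; apply: perm_to_rem.
  apply: (ideal_xmon_perm I_ideal pks); apply: (ideal_pivot_brr I_ideal).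
  - have [<- {2}<-] : (m - 3).+1 = (m - 2)%N /\ (m - 3).+3 = m by lia.
    exact: (ideal_v_sq inQ_ideal (inQ_v _)).
  - rewrite -mE; apply: ideal_low; first by lia.
    apply/allP => j; rewrite mem_rem_uniq // inE => /andP[jk /(allP sm)] /=.
    by lia.
  - by rewrite /= andbT; lia.
  by apply/allP => j /mem_rem /(allP sm) /=; lia.
apply: (ideal_pivot_brr I_ideal (s := [::])) => //; first exact: inQ_v.
  rewrite -mE; apply: ideal_low; first by lia.
  apply/allP => j js; have jm := allP sm _ js; have : j != (m - 2)%N.
    by apply: contraNneq ks => <-.
  by move: jm => /=; lia.
by apply: below_le sm; lia.
Qed.

Lemma ideal_monomial p n a : (M + 20 <= n)%N -> Qmonomial p n a -> I a.
Proof.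
move=> Mn Qa; case: Qa Mn => {p n a} [s m sm|s m sm|m] Mm.
- have -> : m = (m - 2).+2 by lia.
  by apply: ideal_low => //; lia.
- by apply: ideal_high => //; lia.
by apply: (ideal_v_sq I_ideal); apply: I_v; lia.
Qed.

Lemma Qspan_mod_ideal p a : Qspan p a -> exists b c,
  [/\ I b, xpivot_span (M + 20) p c & a = opadd b c].
Proof.
elim=> [|x d _ [m Qd] _ [b [c [Ib Sc ->]]]].
  exists opzero, opzero; split; [exact: ideal0 | exact: opspan0 | ].
  by apply: functional_extensionality => f; rewrite /opadd addr0.
have [Mm|mM] := leqP (M + 20) m.
  exists (opadd (opscale x d) b), c; split=> //.
    exact: (idealD I_ideal (idealZ I_ideal x (ideal_monomial Mm Qd)) Ib).
  by apply: functional_extensionality => f; rewrite /opadd addrA.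
exists b, (opadd (opscale x d) c); split=> //.
  exact: opspanD (opspanZ x (Qmonomial_xpivot_span mM Qd)) Sc.
by apply: functional_extensionality => f; rewrite /opadd addrCA.
Qed.

End NonzeroIdeal.

(** * Infinite dimension and finite codimension *)

(* Monomials with a repeated factor vanish, so sets of factors suffice. *)
Lemma xpivot_span_fintype N p a : xpivot_span N p a ->
  exists x : 'I_#|{: 'I_N * {set 'I_N}}| -> K, a = lincomb x
    ((fun mS : 'I_N * {set 'I_N} => xpivot (map val (enum mS.2)) mS.1) \o enum_val).
Proof.
apply: opspan_lincomb => _ [s [m [sN mN _ ->]]].
have [us|us] := boolP (uniq s); last first.
  exists 0, (Ordinal mN, set0); apply: functional_extensionality => f.
  by rewrite /opscale /xpivot /= xmon_nuniq // scale0r.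
pose S : {set 'I_N} := [set i : 'I_N | val i \in s].
have /xmon_perm[e sS] : perm_eq s (map val (enum S)).
  apply: uniq_perm => [//||j]; first by rewrite (map_inj_uniq val_inj) enum_uniq.
  apply/idP/mapP => [js|[i + ->]]; last by rewrite mem_enum inE.
  by exists (Ordinal (allP sN j js)); rewrite // mem_enum inE.
exists ((-1) ^+ e), (Ordinal mN, S); apply: functional_extensionality => f.
exact: sS.
Qed.

Lemma x_coef0 i f : (x_ i f)@_fset0 = 0.
Proof.
rewrite x_E /xop /linext raddf_sum big1 => [//|S _] /=.
rewrite mcoeffZ /lmulB; have [_|iS] := boolP (i \in S); first by rewrite mcoeff0 mulr0.
rewrite mcoeffZ /mon mcoeffU; case: eqP => [iS0|_]; last by rewrite !mulr0.
by have := fset1U1 i S; rewrite iS0 in_fset0.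
Qed.

Lemma v_x_one_coef0 i j : (v_ i (x_ j one))@_fset0 = (i == j)%:R.
Proof.
have -> : v_ i (x_ j one) = pivot_xmon_br i [:: j] one.
  by rewrite pivot_x_brE v_one linear0 addr0.
case: ltngtP => [ij|ji|->]; last by rewrite pivot_x_br_id /mon mcoeffUU.
- by rewrite pivot_x_br_gt // x_coef0.
by rewrite pivot_xmon_br_below ?mcoeff0 //= ji.
Qed.

Lemma Q_infinite : Q_infinite_dim K.
Proof.
move=> n; exists (fun j : 'I_n => v_ j); split=> [j|c c0 j]; first exact: inQ_v.
have : (lincomb c (fun j : 'I_n => v_ j) (x_ j one))@_fset0 = c j.
  rewrite /lincomb raddf_sum (bigD1 j) //= mcoeffZ v_x_one_coef0 eqxx mulr1.
  rewrite big1 ?addr0 // => i ij; rewrite mcoeffZ v_x_one_coef0.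
  by rewrite (inj_eq val_inj) (negbTE ij) mulr0.
by rewrite c0 mcoeff0.
Qed.

Lemma ideal_finite_codim (I : Op -> Prop) : Q_ideal I ->
  (exists a, I a /\ a <> opzero) -> finite_codim I.
Proof.
move=> I_ideal [a [Ia a0]]; have la := inQ_linear (ideal_inQ I_ideal Ia).
have [p ap0] : exists p, part p a <> opzero.
  apply: NNPP => parts0; apply: a0; rewrite (part_sum la).
  have part0 p : part p a = opzero by apply: NNPP => ap; apply: parts0; exists p.
  by rewrite !part0; apply: functional_extensionality => f; rewrite /opadd addr0.
have [_ Qap] := inQ_part p (ideal_inQ I_ideal Ia).
have [M I_v] := ideal_v_large I_ideal (ideal_part I_ideal p Ia) Qap ap0.
eexists _, _ => q Qq; rewrite (part_sum (inQ_linear Qq)).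
have mod_I r := Qspan_mod_ideal I_ideal I_v (inQ_part r Qq).2.
have [b [c [Ib /xpivot_span_fintype[x ->] ->]]] := mod_I false.
have [b' [c' [Ib' /xpivot_span_fintype[y ->] ->]]] := mod_I true.
exists (fun j : 'I_ _ => x j + y j), (opadd b b'); split; first exact: idealD.
apply: functional_extensionality => f; rewrite lincombD /opadd.
exact: addrACA.
Qed.

End JustInfinite.

Theorem theorem7p4 (K : fieldType) :
  Q_infinite_dim K /\
  (forall I : Op K -> Prop, Q_ideal I ->
     (exists a, I a /\ a <> @opzero K) -> finite_codim I).
Proof. by split; [apply: Q_infinite | apply: ideal_finite_codim]. Qed.
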